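(* Consider the distributed cooperative multi-agent multi-armed bandit problem under the unconstrained reward model with sub-Gaussian rewards, in which all agents use the coop-UCB2 algorithm with parameters $\sigma_g>0$, $\gamma>1$, $\eta\in(0,4)$ and increasing sublogarithmic function $f$. Then the expected cumulative group regret until time $T$ satisfies $$R^{\text{unc}}(T)\le\sum_{i\ne i^*}\frac{4\sigma_g^2\gamma\ln T}{\Delta_iG(\eta)}\left(1+\sqrt{1+\frac{\Delta_i^2MG(\eta)}{2\gamma\sigma_g^2}\frac{f(T)}{\ln T}}\right)+\sum_{i=1}^NL\Delta_i,$$ where $$L=\sum_{k=1}^M(t_k^\dagger-1)+M(1+\epsilon_n)+1+\frac{2M}{\ln(1+\eta)}\left(\frac{1}{(\gamma-1)^2}+\frac{\gamma\ln\big((1+\epsilon_n)(1+\eta)\big)}{\gamma-1}+1\right)$$ and $t_k^\dagger=f^{-1}(\epsilon_c^k)$.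
   Context: There are $M$ agents and $N$ arms. The agents are the nodes of a connected undirected graph $\mathcal G$ with Laplacian $L_{\mathcal G}\in\mathbb R^{M\times M}$ and maximum degree $d_{\max}$. Set $P=I_M-\frac{\kappa}{d_{\max}}L_{\mathcal G}$ with $\kappa\in(0,1]$. The eigenvalues of $P$ are $\lambda_1=1>\lambda_2\ge\dots\ge\lambda_M>-1$ (standing assumption), with corresponding orthonormal eigenvectors $\mathbf u_1,\dots,\mathbf u_M$, $\mathbf u_1=\mathbf 1_M/\sqrt M$; $u_p^d$ denotes the $d$-th entry of $\mathbf u_p$. At each time $t=1,\dots,T$ agent $k$ selects one arm $i^k(t)$; $\xi_i^k(t)=1$ if $i^k(t)=i$ and $0$ otherwise; $n_i^k(T)$ is the number of times agent $k$ selects arm $i$ until time $T$. $r_i^k(t)$ is the realized reward at arm $i$ for agent $k$ at time $t$. For each $i$ and $k$, $\{r_i^k(t)\}_t$ is i.i.d. sub-Gaussian with mean $m_i$; rewards of different agents are independent and identically distributed for a given arm, and rewards at time $t$ are independent of all measurements before time $t$. A real random variable $X$ with mean $m$ is sub-Gaussian (with parameter $\sigma_g>0$) if $\ln\mathbb E[\exp(\beta X)]\le m\beta+\frac{\sigma_g^2\beta^2}{2}$ for all $\beta\in\mathbb R$. Unconstrained reward model: agent $k$ receives $r_{i^k(t)}^k(t)$ at time $t$ irrespective of the choices of other agents. The arm with highest mean is $i^*$; $\Delta_i=m_{i^*}-m_i$. Arm means are distinct. The expected cumulative group regret is $$R^{\text{unc}}(T)=MTm_{i^*}-\mathbb E\Big[\sum_{t=1}^T\sum_{k=1}^Mm_{i^k(t)}\Big]=\sum_{i=1}^N\sum_{k=1}^M\Delta_i\,\mathbb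 E[n_i^k(T)].$$ Cooperative estimation: $\hat{\mathbf n}_i(t)=P(\hat{\mathbf n}_i(t-1)+\boldsymbol\xi_i(t))$, $\hat{\mathbf s}_i(t)=P(\hat{\mathbf s}_i(t-1)+\mathbf r_i(t))$, $\hat{\mathbf n}_i(0)=\hat{\mathbf s}_i(0)=0$, $\hat\mu_i^k(t)=\hat s_i^k(t)/\hat n_i^k(t)$, where $\hat{\mathbf n}_i,\hat{\mathbf s}_i,\boldsymbol\xi_i,\mathbf r_i$ are the vectors over $k\in\{1,\dots,M\}$ with entries $\hat n_i^k,\hat s_i^k,\xi_i^k,r_i^k\xi_i^k$. coop-UCB2 algorithm: for $t\le N$ every agent selects arm $t$ (each agent samples each arm once). For $t>N$, each agent $k$ selects an arm maximizing $Q_i^k(t-1)=\hat\mu_i^k(t-1)+C_i^k(t-1)$ over $i\in\{1,\dots,N\}$, where $$C_i^k(t-1)=\sigma_g\sqrt{\frac{2\gamma}{G(\eta)}\cdot\frac{\hat n_i^k(t-1)+f(t-1)}{M\hat n_i^k(t-1)}\cdot\frac{\ln(t-1)}{\hat n_i^k(t-1)}},\qquad G(\eta)=1-\frac{\eta^2}{16}.$$ The estimates are updated at each time with the cooperative estimation algorithm. Here $f$ is increasing and sublogarithmic ($f(t)/\ln t\to0$), and $f^{-1}$ is its inverse (the notation presupposes that each $\epsilon_c^k$ lies in the range of $f$). The graph explore-exploit index is $$\epsilon_n=\sqrt M\sum_{p=2}^M\frac{|\lambda_p|}{1-|\lambda_p|}.$$ The nodal explore-exploit centrality index of node $k$ is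 $$\epsilon_c^k=M\sum_{p=1}^M\sum_{j=2}^M\frac{|\lambda_p\lambda_j|}{1-|\lambda_p\lambda_j|}a_{pj}(k),$$ where $a_{pj}(k)=\nu_{pj}^{\text{+sum}}u_p^ku_j^k$ if $\lambda_p\lambda_j\ge0$ and $u_p^ku_j^k\ge0$; $a_{pj}(k)=\nu_{pj}^{\text{-sum}}u_p^ku_j^k$ if $\lambda_p\lambda_j\ge0$ and $u_p^ku_j^k\le0$; $a_{pj}(k)=\nu_{pj}^{\max}|u_p^ku_j^k|$ if $\lambda_p\lambda_j<0$; with $\nu_{pj}^{\text{+sum}}=\sum_{d=1}^Mu_p^du_j^d\,\mathds 1(u_p^du_j^d\ge0)$, $\nu_{pj}^{\text{-sum}}=\sum_{d=1}^Mu_p^du_j^d\,\mathds 1(u_p^du_j^d\le0)$, $\nu_{pj}^{\max}=\max\{|\nu_{pj}^{\text{-sum}}|,\nu_{pj}^{\text{+sum}}\}$, where $\mathds 1(\cdot)$ is the indicator function. *)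

(* Defs.v *)
From HB Require Import structures.
From mathcomp Require Import all_boot all_order all_algebra.
From mathcomp Require Import all_classical all_reals all_analysis.

Set Implicit Arguments.
Unset Strict Implicit.
Unset Printing Implicit Defensive.

Import Order.TTheory GRing.Theory Num.Theory.
Import numFieldNormedType.Exports.

Local Open Scope classical_set_scope.
Local Open Scope ring_scope.

Section Network.
Context (R : realType) (M : nat).

Definition connected_graph (e : rel 'I_M) : Prop :=
  [/\ symmetric e, irreflexive e & forall k j : 'I_M, connect e k j].

Definition degree (e : rel 'I_M) (k : 'I_M) : nat := #|[set j | e k j]%SET|.

Definition max_degree (e : rel 'I_M) : nat := (\max_(k < M) degree e k)%N.

Definition laplacian (e : rel 'I_M) : 'M[R]_M :=
  \matrix_(k, j) ((degree e k)%:R *+ (k == j) - (e k j)%:R).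

(* For a single node the maximum degree is 0; then the Laplacian vanishes and
   the matrix is the identity whatever the value of kappa / 0. *)
Definition consensus_matrix (e : rel 'I_M) (kappa : R) : 'M[R]_M :=
  1%:M - (kappa / (max_degree e)%:R) *: laplacian e.

(* Indices start at 0: [lambda p] with [p = 0] is the leading eigenvalue. *)
Definition ordered_eigenbasis (P : 'M[R]_M) (lambda : 'I_M -> R)
    (u : 'I_M -> 'cV[R]_M) : Prop :=
  [/\ forall p, P *m u p = lambda p *: u p,
      forall p q, \sum_(d < M) u p d 0 * u q d 0 = (p == q)%:R,
      forall p q : 'I_M, (p <= q)%N -> lambda q <= lambda p &
      forall p : 'I_M, p = 0%N :> nat ->
        lambda p = 1 /\ u p = const_mx (Num.sqrt M%:R)^-1].

Definition graph_explore_exploit_index (lambda : 'I_M -> R) : R :=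
  Num.sqrt M%:R * \sum_(p < M | (0 < p)%N) `|lambda p| / (1 - `|lambda p|).

Section Nodal.
Variables (lambda : 'I_M -> R) (u : 'I_M -> 'cV[R]_M).

Definition nu_plus_sum (p j : 'I_M) : R :=
  \sum_(d < M | 0 <= u p d 0 * u j d 0) u p d 0 * u j d 0.

Definition nu_minus_sum (p j : 'I_M) : R :=
  \sum_(d < M | u p d 0 * u j d 0 <= 0) u p d 0 * u j d 0.

Definition nu_max (p j : 'I_M) : R :=
  Num.max `|nu_minus_sum p j| (nu_plus_sum p j).

(* When [u p k 0 * u j k 0 = 0] the first two cases both give 0. *)
Definition nodal_coef (k p j : 'I_M) : R :=
  if 0 <= lambda p * lambda j then
    if 0 <= u p k 0 * u j k 0
    then nu_plus_sum p j * (u p k 0 * u j k 0)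
    else nu_minus_sum p j * (u p k 0 * u j k 0)
  else nu_max p j * `|u p k 0 * u j k 0|.

Definition nodal_explore_exploit_index (k : 'I_M) : R :=
  M%:R * \sum_(p < M) \sum_(j < M | (0 < j)%N)
    `|lambda p * lambda j| / (1 - `|lambda p * lambda j|) * nodal_coef k p j.

End Nodal.

Fixpoint coop_estimate (P : 'M[R]_M) (x : nat -> 'cV[R]_M) (t : nat)
    : 'cV[R]_M :=
  if t is t'.+1 then P *m (coop_estimate P x t' + x t) else 0.

End Network.

Section Probability.
Context d (Omega : measurableType d) (R : realType) (Pr : probability Omega R).

Definition subgaussian (m sigma : R) (X : Omega -> R) : Prop :=
  ('E_Pr[X] = m%:E)%E /\
  forall beta : R,
    (lne ('M_Pr X beta) <= (m * beta + sigma ^+ 2 * beta ^+ 2 / 2)%:E)%E.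

Definition identically_distributed (X Y : Omega -> R) : Prop :=
  forall B : set R, measurable B -> Pr (X @^-1` B) = Pr (Y @^-1` B).

Definition mutually_independent (I : eqType) (J : pred I) (X : I -> Omega -> R)
    : Prop :=
  forall (s : seq I) (B : I -> set R),
    uniq s -> all J s -> (forall i, measurable (B i)) ->
    Pr (\big[setI/setT]_(i <- s) X i @^-1` B i) =
    (\prod_(i <- s) Pr (X i @^-1` B i))%E.

Definition independent_classes (F G : set (set Omega)) : Prop :=
  forall A B, F A -> G B -> Pr (A `&` B) = (Pr A * Pr B)%E.

End Probability.

(* [r i k t w] is the reward of arm [i] for agent [k] at time [t], [sel k t w]
   the arm selected by agent [k] at time [t], on the sample path [w].  Times
   are [1, 2, ...]; the values at [t = 0] are never used. *)
Section Bandit.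
Context d (Omega : measurableType d) (R : realType) (Pr : probability Omega R).
Context (M N : nat).
Variables (r : 'I_N -> 'I_M -> nat -> Omega -> R)
          (sel : 'I_M -> nat -> Omega -> 'I_N).

Definition rewards_at (t : nat) : set (set Omega) :=
  <<s [set A | exists i k (B : set R), measurable B /\ A = r i k t @^-1` B] >>.

(* The information on which play at time [t] is based: the rewards observed
   before [t] together with the selections up to [t].  Including the latter
   matters only when ties between arms are broken at random, in which case the
   randomization, too, must not look at the rewards to come. *)
Definition history (t : nat) : set (set Omega) :=
  <<s [set A | exists k s (i : 'I_N), (1 <= s <= t)%N /\
                 A = [set w | sel k s w = i]]
      `|` [set A | exists k s (B : set R), [/\ (1 <= s < t)%N, measurable B &
                 A = [set w | B (r (sel k s w) k s w)]]] >>.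

Definition subgaussian_rewards (m : 'I_N -> R) (sigma : R) : Prop :=
  [/\ forall i k t, (0 < t)%N -> subgaussian Pr (m i) sigma (r i k t),
      forall i k j t s, (0 < t)%N -> (0 < s)%N ->
        identically_distributed Pr (r i k t) (r i j s),
      forall i, mutually_independent Pr
        [pred kt : 'I_M * nat | (0 < kt.2)%N] (fun kt => r i kt.1 kt.2) &
      forall t, (0 < t)%N ->
        independent_classes Pr (rewards_at t) (history t)].

Section Policy.
Variable P : 'M[R]_M.

Definition n_hat (i : 'I_N) (k : 'I_M) (t : nat) (w : Omega) : R :=
  coop_estimate P (fun s => \col_j (sel j s w == i)%:R) t k 0.

Definition s_hat (i : 'I_N) (k : 'I_M) (t : nat) (w : Omega) : R :=
  coop_estimate P (fun s => \col_j (r i j s w * (sel j s w == i)%:R)) t k 0.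

Definition mu_hat i k t w : R := s_hat i k t w / n_hat i k t w.

Variables (sigma gamma G : R) (f : R -> R).

Definition ucb_width i k (t : nat) w : R :=
  sigma * Num.sqrt (2 * gamma / G
    * ((n_hat i k t w + f t%:R) / (M%:R * n_hat i k t w))
    * (ln t%:R / n_hat i k t w)).

Definition ucb_index i k t w : R := mu_hat i k t w + ucb_width i k t w.

(* Ties in the maximization are broken arbitrarily. *)
Definition coop_UCB2_policy : Prop :=
  forall k t w,
    ((0 < t <= N)%N -> sel k t w = t.-1 :> nat) /\
    ((N < t)%N -> forall i,
       ucb_index i k t.-1 w <= ucb_index (sel k t w) k t.-1 w).

End Policy.

Definition group_regret (m : 'I_N -> R) (istar : 'I_N) (T : nat) : \bar R :=
  ((M%:R * T%:R * m istar)%:E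
   - 'E_Pr[fun w => (\sum_(1 <= t < T.+1) \sum_(k < M) m (sel k t w))%R])%E.

End Bandit.

Definition G_factor (R : realType) (eta : R) : R := 1 - eta ^+ 2 / 16.

(* [D] is the domain of [f]: any set of positive reals containing the time
   instants, e.g. [[1, +oo[] for [f t = sqrt (ln t)]. *)
Definition increasing_sublogarithmic (R : realType) (D : set R) (f : R -> R)
    : Prop :=
  [/\ D `<=` [set t | 0 < t],
      forall n : nat, (0 < n)%N -> D n%:R,
      {in D &, {homo f : x y / x < y}} &
      f t / ln t @[t --> within D (pinfty_nbhs R)] --> (0 : R)].

Definition regret_constant (R : realType) (M : nat) (tdag : 'I_M -> R)
    (eps_n gamma eta : R) : R :=
  \sum_(k < M) (tdag k - 1) + M%:R * (1 + eps_n) + 1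
  + 2 * M%:R / ln (1 + eta)
    * (1 / (gamma - 1) ^+ 2
       + gamma * ln ((1 + eps_n) * (1 + eta)) / (gamma - 1) + 1).

(* Main.v *)
Require Import Defs.
From HB Require Import structures.
From mathcomp Require Import all_boot all_order all_algebra.
From mathcomp Require Import all_classical all_reals all_analysis.
From mathcomp Require Import measurable_realfun.
From mathcomp Require Import ring lra.

Set Implicit Arguments.
Unset Strict Implicit.
Unset Printing Implicit Defensive.

Import Order.TTheory GRing.Theory Num.Theory.
Import numFieldNormedType.Exports.

Local Open Scope classical_set_scope.
Local Open Scope ring_scope.

(** The regret is the sum over the suboptimal arms [i] of [Delta i] times the
expected number of plays of [i] by all the agents, so it suffices to bound that
number.

Suppose agent [k] plays [i] at time [t + 1], after the sampling phase.  By the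
choice of the policy the index of [i] is then at least the index of the best
arm, so one of three things happened: the upper confidence bound of the best arm
lies below its mean; the lower confidence bound of [i] lies above its mean; or
[Delta i] is less than twice the confidence width of [i].  In the third case the
width is large only because the estimated count [n_hat] is small: solving a
quadratic inequality gives [n_hat < exploration i] ([n_hat_small]).  Since every
agent estimates the average number of plays up to [eps_n]
([coop_estimate_mean_dist]), the group as a whole has then played [i] at most
[M * (exploration i + eps_n)] times, and these plays are counted pathwise
([plays_below_threshold_le]).

The first two cases are large deviations of [s_hat - m i * n_hat].  This is the
sum, over the past rounds [s] and the agents [j] that played [i] there, of
centered rewards with weights [(P ^+ (t - s)) k j]: a martingale transform whose
quadratic variation is the sum of the squared weights.  The exponential of the
usual sub-Gaussian compensated sum has expectation at most 1
([expectation_exp_log_martingale]).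
Expanding the powers of [P] in the eigenbasis bounds the quadratic variation by
[(n_hat + eps_c k) / M] ([coop_estimate_variance]), hence by
[W = (n_hat + f t) / M] as soon as [eps_c k <= f t], which holds for
[t >= tdag k].  The width is a multiple of [sqrt W], but [W] is random, so no
single exponential tilt is optimal: the range of [W], whose endpoints have ratio
at most [t], is cut into about [ln t / ln (1 + eta)] bands of ratio [1 + eta],
and within one band the tilt tuned to the middle loses only the factor
[G_factor eta] in the exponent ([one_le_sum_tilted]).  Each of the two events
thus has its indicator bounded by a random variable of expectation
[(ln t / ln (1 + eta) + 1) * t^(- gamma)] ([expectation_tail_bound]), which is
summable ([sum_band_tail_le]).

The times [t < tdag k] are counted as if every play were bad.  Since there are at
least two arms when some arm is suboptimal, only times [t >= 2] matter, and at
most [max 0 (tdag k - 1)] of those lie below [tdag k].  This number may exceed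
[tdag k - 1]; the series above starts at [t = 2], and the term reserved for
[t = 1] in the closed form of the theorem pays for the difference
([regret_constant_dominates]). *)

(** * Expectations of products of independent variables *)

Section Independence.
Context d (Omega : measurableType d) (R : realType) (Pr : probability Omega R).

Import HBNNSimple.

(** The hypothesis says that the measure of density [W], transported by [X], is
[c] times the law of [X]; the conclusion extends this from indicators to
nonnegative functions, through simple functions and monotone convergence.  The
factorizations below release one variable at a time in this way. *)
Lemma integral_weighted_comp (W X : Omega -> R) (c : R) :
  measurable_fun [set: Omega] W -> (forall w, 0 <= W w) ->
  measurable_fun [set: Omega] X -> 0 <= c ->
  (forall B : set R, measurable B ->
     \int[Pr]_w (W w * \1_B (X w))%:E = (c%:E * Pr (X @^-1` B)))%E ->
  forall g : R -> R, measurable_fun [set: R] g -> (forall x, 0 <= g x) ->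
    (\int[Pr]_w (W w * g (X w))%:E = c%:E * \int[Pr]_w (g (X w))%:E)%E.
Proof.
move=> mW W0 mX c0 H g mg g0.
have mge : measurable_fun [set: R] (fun x => (g x)%:E) by exact/measurable_EFinP.
pose h := nnsfun_approx measurableT mge.
have hcvg x : (EFin \o h ^~ x) @ \oo --> (g x)%:E.
  by apply: (cvg_nnsfun_approx measurableT mge) => // y _; rewrite /= lee_fin.
have mh n : measurable_fun [set: R] (h n) by exact/measurable_funP.
have hnd n p x : (n <= p)%N -> h n x <= h p x.
  by move=> np; exact/lefP/nd_nnsfun_approx.
have simple n : (\int[Pr]_w (W w * h n (X w))%:E =
                 c%:E * \int[Pr]_w (h n (X w))%:E)%E.
  have mB y : measurable (h n @^-1` [set y]) by [].
  have m1 y : measurable_fun [set: Omega]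
      (fun w => \1_(h n @^-1` [set y]) (X w) : R).
    by apply: measurableT_comp => //; exact: measurable_indic.
  pose s : seq R := finmap.enum_fset (fset_set (range (h n))).
  have hE x : h n x = \sum_(y <- s)
                        y * \1_(h n @^-1` [set y]) x.
    by rewrite {1}fimfunE fsbig_finite.
  have y0 x y : 0 <= y * \1_(h n @^-1` [set y]) x.
    by have := nnfun_muleindic_ge0 (h n) y x; rewrite -EFinM lee_fin.
  transitivity (\int[Pr]_w (\sum_(y <- s)
       (W w * (y * \1_(h n @^-1` [set y]) (X w)))%:E))%E.
    by apply: eq_integral => w _; rewrite hE mulr_sumr sumEFin.
  transitivity (c%:E * \int[Pr]_w (\sum_(y <- s)
       (y * \1_(h n @^-1` [set y]) (X w))%:E))%E; last first.
    by congr (_ * _)%E; apply: eq_integral => w _; rewrite hE sumEFin.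
  rewrite ge0_integral_sum //; last 2 first.
  - move=> y; apply/measurable_EFinP; apply: measurable_funM => //.
    exact: measurable_funM.
  - by move=> y w _; rewrite lee_fin mulr_ge0.
  rewrite ge0_integral_sum //; last 2 first.
  - by move=> y; apply/measurable_EFinP; exact: measurable_funM.
  - by move=> y w _; rewrite lee_fin.
  rewrite ge0_sume_distrr; last first.
    by move=> y _; apply: integral_ge0 => w _; rewrite lee_fin.
  apply: eq_bigr => y _.
  have [yneg|ynn] := ltP y 0.
    have z x : y * \1_(h n @^-1` [set y]) x = 0 :> R.
      apply/eqP; rewrite eq_le y0 andbT.
      by rewrite mulr_le0_ge0 // ltW.
    under eq_integral do rewrite z mulr0.
    under [in RHS]eq_integral do rewrite z.
    by rewrite integral0 mule0.
  transitivity (\int[Pr]_w (y%:E * (W w * \1_(h n @^-1` [set y]) (X w))%:E))%E.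
    by apply: eq_integral => w _; rewrite -EFinM mulrCA.
  rewrite ge0_integralZl_EFin //; last 2 first.
  - by move=> w _; rewrite lee_fin mulr_ge0.
  - by apply/measurable_EFinP; exact: measurable_funM.
  rewrite H // muleCA; congr (_ * _)%E.
  transitivity (\int[Pr]_w (y%:E * (\1_(h n @^-1` [set y]) (X w))%:E))%E;
    last by apply: eq_integral => w _; rewrite -EFinM.
  rewrite ge0_integralZl_EFin //; last exact/measurable_EFinP.
  congr (_ * _)%E.
  transitivity (\int[Pr]_w (\1_(X @^-1` (h n @^-1` [set y])) w)%:E)%E.
    by rewrite integral_indic // ?setIT // -[X in measurable X]setTI; exact: mX.
  by [].
transitivity (limn (fun n => \int[Pr]_w (W w * h n (X w))%:E))%E.
  rewrite -monotone_convergence //.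
  - apply: eq_integral => w _; apply/esym/cvg_lim => //.
    under eq_fun do rewrite EFinM.
    by rewrite EFinM; apply: cvgeZl => //; exact: hcvg.
  - move=> n; apply/measurable_EFinP; apply: measurable_funM => //.
    exact: measurableT_comp.
  - by move=> n w _; rewrite lee_fin mulr_ge0.
  - by move=> w _ n p np; rewrite lee_fin ler_wpM2l // hnd.
under eq_fun do rewrite simple.
have mhX n : measurable_fun [set: Omega] (fun w => (h n (X w))%:E).
  by apply/measurable_EFinP; exact: measurableT_comp.
rewrite limeMl //; last first.
  apply: ereal_nondecreasing_is_cvgn => n p np.
  by apply: ge0_le_integral => // w _; rewrite lee_fin ?hnd.
congr (_ * _)%E; rewrite -monotone_convergence //.
- by apply: eq_integral => w _; apply/cvg_lim => //; exact: hcvg.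
- by move=> n w _; rewrite lee_fin.
- by move=> w _ n p np; rewrite lee_fin hnd.
Qed.

Lemma fine_probK (A : set Omega) : measurable A -> ((fine (Pr A))%:E = Pr A)%E.
Proof. by move=> mA; rewrite fineK // fin_num_measure. Qed.

(** Independence gives the product rule for indicators.  The induction replaces
the indicators by the functions [g i] one index at a time, which is why the
intermediate statement mixes a product of [g i] with a product of indicators. *)
Lemma expectation_prod_independent (I : eqType) (J : pred I)
    (X : I -> Omega -> R) (g : I -> R -> R) (e : I -> R) :
  mutually_independent Pr J X ->
  (forall i, measurable_fun [set: Omega] (X i)) ->
  (forall i, measurable_fun [set: R] (g i)) ->
  (forall i x, 0 <= g i x) ->
  (forall i, J i -> \int[Pr]_w (g i (X i w))%:E = (e i)%:E)%E ->
  forall s, uniq s -> all J s ->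
    (\int[Pr]_w (\prod_(i <- s) g i (X i w))%:E = (\prod_(i <- s) e i)%:E)%E.
Proof.
move=> indep mX mg g0 ge s us Js.
have e0 i : J i -> 0 <= e i.
  by move=> Ji; rewrite -lee_fin -ge // integral_ge0 // => w _; rewrite lee_fin.
have mpre i B : measurable B -> measurable (X i @^-1` B).
  by move=> mB; rewrite -[X in measurable X]setTI; exact: mX.
suff H s1 s2 (B : I -> set R) : uniq (s1 ++ s2) -> all J (s1 ++ s2) ->
    (forall i, measurable (B i)) ->
    (\int[Pr]_w ((\prod_(i <- s1) g i (X i w)) *
                 (\prod_(i <- s2) \1_(B i) (X i w)))%:E =
    ((\prod_(i <- s1) e i) * (\prod_(i <- s2) fine (Pr (X i @^-1` B i))))%:E)%E.
  have := H s [::] (fun=> setT).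
  rewrite cats0 big_nil mulr1 => <- //.
  by apply: eq_integral => w _; rewrite big_nil mulr1.
elim: s1 s2 B => [|i s1 IH] s2 B us12 Js12 mB.
  rewrite big_nil mul1r.
  have -> : (\prod_(i <- s2) fine (Pr (X i @^-1` B i)))%:E =
            Pr (\big[setI/setT]_(i <- s2) (X i @^-1` B i)).
    rewrite indep // -prodEFin; apply: eq_bigr => i _.
    by rewrite fine_probK //; exact: mpre.
  have mI : measurable (\big[setI/setT]_(i <- s2) (X i @^-1` B i)).
    by apply: bigsetI_measurable => i _; exact: mpre.
  rewrite -[X in Pr X]setIT -integral_indic //; apply: eq_integral => w _.
  rewrite big_nil mul1r; congr (_%:E).
  elim: {us12 Js12 mI} s2 => [|j s' IHs]; first by rewrite !big_nil indicT.
  by rewrite !big_cons IHs indicI.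
move: us12 Js12 => /= /andP[inotin us12] /andP[Ji Js12].
have neq j : j \in s1 ++ s2 -> (j == i) = false.
  by move=> js; apply/negbTE; apply: contraNneq inotin => <-.
pose W w := (\prod_(j <- s1) g j (X j w)) * (\prod_(j <- s2) \1_(B j) (X j w)).
have mind j : measurable_fun [set: Omega] (fun w => \1_(B j) (X j w) : R).
  by apply: measurableT_comp => //; exact: measurable_indic.
have mW : measurable_fun [set: Omega] W.
  apply: measurable_funM; apply: measurable_prod => j _ //.
  exact: measurableT_comp.
have W0 w : 0 <= W w.
  by rewrite mulr_ge0 // prodr_ge0.
pose c := \prod_(j <- s1) e j * \prod_(j <- s2) fine (Pr (X j @^-1` B j)).
have c0 : 0 <= c.
  rewrite mulr_ge0 //; last by rewrite prodr_ge0 // => j _; exact: fine_ge0.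
  rewrite big_seq prodr_ge0 // => j js; apply: e0.
  by move/allP : Js12; apply; rewrite mem_cat js.
have HW B' : measurable B' ->
    (\int[Pr]_w (W w * \1_B' (X i w))%:E = c%:E * Pr (X i @^-1` B'))%E.
  move=> mB'.
  (* the induction hypothesis is used with [i] moved among the indicators *)
  pose B2 j := if j == i then B' else B j.
  have E1 (F : set R -> I -> R) :
      \prod_(j <- s2) F (B2 j) j = \prod_(j <- s2) F (B j) j.
    rewrite big_seq [RHS]big_seq; apply: eq_bigr => j js.
    by rewrite /B2 neq // mem_cat js orbT.
  have := IH (i :: s2) B2.
  rewrite (perm_uniq (permEl (perm_catCA s1 [:: i] s2))) /= inotin us12.
  rewrite (perm_all _ (permEl (perm_catCA s1 [:: i] s2))) /= Ji Js12.
  move=> /(_ isT isT); have mB2 j : measurable (B2 j) by rewrite /B2; case: ifP.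
  move=> /(_ mB2).
  rewrite big_cons (E1 (fun A j => fine (Pr (X j @^-1` A)))) /B2 eqxx -/(B2) => H.
  rewrite -(fine_probK (mpre i _ mB')) -EFinM.
  transitivity (\prod_(j <- s1) e j * (fine (Pr (X i @^-1` B'))
     * \prod_(j <- s2) fine (Pr (X j @^-1` B j))))%:E; last first.
    by congr (_%:E); rewrite /c; ring.
  rewrite -H; apply: eq_integral => w _; congr (_%:E).
  rewrite big_cons eqxx (E1 (fun A j => \1_A (X j w))) /W.
  by rewrite [\1_B' _ * _]mulrC mulrA.
transitivity (\int[Pr]_w (W w * g i (X i w))%:E)%E.
  by apply: eq_integral => w _; congr (_%:E); rewrite big_cons /W; ring.
rewrite (integral_weighted_comp mW W0 (mX i) c0 HW (mg i) (g0 i)) ge //.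
by rewrite -EFinM big_cons /c; congr (_%:E); ring.
Qed.

(** Used with [G] the past and [F] the rewards of the next round.  First [V] is
released against the indicators of the events of [U], then [U] against [V]. *)
Lemma expectationM_independent_classes (F G : set (set Omega)) (U V : Omega -> R)
    (eV : R) :
  independent_classes Pr F G ->
  measurable_fun [set: Omega] U -> measurable_fun [set: Omega] V ->
  (forall w, 0 <= U w) -> (forall w, 0 <= V w) ->
  (forall B : set R, measurable B -> G (U @^-1` B)) ->
  (forall B : set R, measurable B -> F (V @^-1` B)) ->
  (\int[Pr]_w (V w)%:E = eV%:E)%E ->
  (\int[Pr]_w (V w * U w)%:E = eV%:E * \int[Pr]_w (U w)%:E)%E.
Proof.
move=> indep mU mV U0 V0 GU FV eVE.
have eV0 : 0 <= eV.
  by rewrite -lee_fin -eVE integral_ge0 // => w _; rewrite lee_fin.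
have nE w (Z : Omega -> R) : 0 <= Z w -> Z w = `|Z w| by move/ger0_norm.
have mpre (Z : Omega -> R) B : measurable_fun [set: Omega] Z ->
   measurable B -> measurable (Z @^-1` B).
  by move=> mZ mB; rewrite -[X in measurable X]setTI; exact: mZ.
have mnorm : measurable_fun [set: R] (fun x : R => `|x|).
  exact: normr_measurable.
have key B : measurable B ->
    (\int[Pr]_w (V w * \1_B (U w))%:E = eV%:E * Pr (U @^-1` B))%E.
  move=> mB; have mUB := mpre U B mU mB.
  have mW : measurable_fun [set: Omega] (\1_(U @^-1` B) : Omega -> R).
    exact: measurable_indic.
  have := @integral_weighted_comp (\1_(U @^-1` B)) V
    (fine (Pr (U @^-1` B))) mW (fun w => ler0n _ _) mV.
  move=> /(_ (fine_ge0 (measure_ge0 _ _))).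
  have H B' : measurable B' ->
    (\int[Pr]_w (\1_(U @^-1` B) w * \1_B' (V w))%:E =
     (fine (Pr (U @^-1` B)))%:E * Pr (V @^-1` B'))%E.
    move=> mB'; rewrite fine_probK // muleC -indep; [|exact: FV|exact: GU].
    rewrite -[X in Pr X]setIT -integral_indic //; last first.
      by apply: measurableI => //; exact: mpre.
    by apply: eq_integral => w _; rewrite indicI /= mulrC.
  move=> /(_ H _ mnorm (fun x => normr_ge0 x)).
  rewrite fine_probK // => E1.
  transitivity (\int[Pr]_w (\1_(U @^-1` B) w * `|V w|)%:E)%E.
    by apply: eq_integral => w _; rewrite -nE // mulrC.
  rewrite E1 muleC; congr (_ * _)%E; rewrite -eVE.
  by apply: eq_integral => w _; rewrite -nE.
have := integral_weighted_comp mV V0 mU eV0 key mnorm (fun x => normr_ge0 x).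
under eq_integral do rewrite -nE //.
by under [X in (_ = _ * X)%E -> _]eq_integral do rewrite -nE //.
Qed.

End Independence.

(** * The exponential supermartingale of the weighted rewards *)

Section ExpSupermartingale.
Context d (Omega : measurableType d) (R : realType) (Pr : probability Omega R).

Lemma subgaussian_exp_centered (m sigma b : R) (X : Omega -> R) :
  measurable_fun [set: Omega] X -> subgaussian Pr m sigma X ->
  (\int[Pr]_w (expR (b * (X w - m) - sigma ^+ 2 * b ^+ 2 / 2))%:E <= 1)%E.
Proof.
move=> mX [_ /(_ b)]; rewrite /mmt_gen_fun unlock => H.
set K := m * b + sigma ^+ 2 * b ^+ 2 / 2 in H *.
set M := (\int[Pr]_w _)%E in H.
have M0 : (0 <= M)%E by apply: integral_ge0 => w _; rewrite lee_fin expR_ge0.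
have MK : (M <= (expR K)%:E)%E.
  have: (expeR (lne M) <= expeR K%:E)%E by rewrite lee_expeR.
  by rewrite lneK // in_itv /= M0 leey.
apply: (@le_trans _ _ ((expR (- K))%:E * M)%E).
  rewrite le_eqVlt; apply/orP; left; apply/eqP.
  rewrite /M -ge0_integralZl_EFin //; last 2 first.
  - by move=> w _; rewrite lee_fin expR_ge0.
  - apply/measurable_EFinP; apply: measurableT_comp => //.
    exact: measurable_funM.
  apply: eq_integral => w _; rewrite -EFinM -expRD; congr ((expR _)%:E).
  by rewrite /K /=; lra.
apply: (@le_trans _ _ ((expR (- K))%:E * (expR K)%:E)%E).
  by rewrite lee_wpmul2l // lee_fin expR_ge0.
by rewrite -EFinM -expRD addNr expR0.
Qed.

Context (M N : nat).
Variables (r : 'I_N -> 'I_M -> nat -> Omega -> R)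
  (sel : 'I_M -> nat -> Omega -> 'I_N).
Hypothesis mr : forall i k t, measurable_fun [set: Omega] (r i k t).
Hypothesis msel : forall k t i, (0 < t)%N -> measurable [set w | sel k t w = i].

(** A name for the generating family, so that measurability with respect to the
past can be proved by the composition rules on [g_sigma_algebraType]. *)
Definition history_gen (t : nat) : set (set Omega) :=
  [set A | exists k s (i : 'I_N), (1 <= s <= t)%N /\
                 A = [set w | sel k s w = i]]
      `|` [set A | exists k s (B : set R), [/\ (1 <= s < t)%N, measurable B &
                 A = [set w | B (r (sel k s w) k s w)]]].

Definition rewards_gen (t : nat) : set (set Omega) :=
  [set A | exists i k (B : set R), measurable B /\ A = r i k t @^-1` B].

Lemma history_measurable t : history r sel t `<=` measurable.
Proof.
apply: smallest_sub; first exact: sigma_algebra_measurable.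
move=> A [[k [s [i [/andP[s1 _] ->]]]]|[k [s [B [/andP[s1 _] mB ->]]]]].
  exact: msel.
have -> : [set w | B (r (sel k s w) k s w)] =
    \bigcup_(i in [set: 'I_N]) ([set w | sel k s w = i] `&` r i k s @^-1` B).
  apply/seteqP; split => w /=.
    by move=> Bw; exists (sel k s w).
  by move=> [i _ [<-]].
apply: fin_bigcup_measurable => [|i _]; first exact: finite_finset.
apply: measurableI; first exact: msel.
by rewrite -[X in measurable X]setTI; exact: mr.
Qed.

Lemma measurable_history_sel t k s i : (1 <= s <= t)%N ->
  measurable_fun [set: g_sigma_algebraType (history_gen t)]
    (fun w => (sel k s w == i)%:R : R).
Proof.
move=> st.
have -> : (fun w => (sel k s w == i)%:R : R) = \1_[set w | sel k s w = i].
  apply/funext => w; rewrite indicE; congr ((nat_of_bool _)%:R).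
  by apply/idP/idP => [/eqP E|]; [exact/mem_set|move/set_mem => /= ->].
apply: measurable_indic; apply: sub_gen_smallest; left.
by exists k, s, i.
Qed.

(** The reward of arm [i] is not part of the past, but its product with the
indicator that [i] was selected is: it can be computed from the observed
reward. *)
Lemma measurable_history_reward t k s i : (1 <= s < t)%N ->
  measurable_fun [set: g_sigma_algebraType (history_gen t)]
    (fun w => (sel k s w == i)%:R * r i k s w).
Proof.
move=> st.
have -> : (fun w => (sel k s w == i)%:R * r i k s w) =
          (fun w => (sel k s w == i)%:R * r (sel k s w) k s w).
  by apply/funext => w; case: eqP => [->//|_]; rewrite !mul0r.
apply: measurable_funM.
  by apply: measurable_history_sel; move/andP: st => [-> /ltnW].
move=> _ B mB; rewrite setTI; apply: sub_gen_smallest; right.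
by exists k, s, B.
Qed.

Variables (m : 'I_N -> R) (sigma : R).
Hypothesis hr : subgaussian_rewards Pr r sel m sigma.
Variables (i : 'I_N) (c : nat -> 'I_M -> R).

Definition subgaussian_increment (b X : R) : R :=
  b * (X - m i) - sigma ^+ 2 * b ^+ 2 / 2.

(** The logarithm of the exponential supermartingale that the deterministic weights
[c] attach to the observed rewards of arm [i]. *)
Definition log_martingale (n : nat) (w : Omega) : R :=
  \sum_(s < n) \sum_(j < M)
    (sel j s.+1 w == i)%:R * subgaussian_increment (c s j) (r i j s.+1 w).

Lemma measurable_history_log_martingale n t : (n < t)%N ->
  measurable_fun [set: g_sigma_algebraType (history_gen t)] (log_martingale n).
Proof.
move=> nt; apply: measurable_sum => s; apply: measurable_sum => j.
have sn : (s.+1 < t)%N by apply: leq_ltn_trans nt.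
have -> : (fun w => (sel j s.+1 w == i)%:R
                * subgaussian_increment (c s j) (r i j s.+1 w)) =
   (fun w => c s j * ((sel j s.+1 w == i)%:R * r i j s.+1 w) -
     (sel j s.+1 w == i)%:R * (c s j * m i + sigma ^+ 2 * c s j ^+ 2 / 2)).
  by apply/funext => w; rewrite /subgaussian_increment; lra.
apply: measurable_funB; apply: measurable_funM => //.
- by apply: measurable_history_reward.
- by apply: measurable_history_sel; rewrite /= ltnW.
Qed.

(** The round [n + 1] is split according to the set [S] of the agents that select
arm [i].  On each piece the past factor [U S] and the reward factor [V S] are
independent, and [V S] is a product of independent variables of expectation at
most 1. *)
Lemma expectation_exp_log_martingale n :
  (\int[Pr]_w (expR (log_martingale n w))%:E <= 1)%E.
Proof.
have [sg _ ind indc] := hr.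
elim: n => [|n IH].
  under eq_integral do rewrite /log_martingale big_ord0 expR0.
  rewrite integral_cst //.
  by rewrite mul1e; exact: sprobability_setT.
pose t := n.+1.
pose sset w : {set 'I_M} := [set j | sel j t w == i]%SET.
pose U S w := expR (log_martingale n w) * (sset w == S)%:R.
pose g (kt : 'I_M * nat) x := expR (subgaussian_increment (c n kt.1) x).
pose V (S : {set 'I_M}) w :=
  \prod_(kt <- [seq (j, t) | j <- enum S]) g kt (r i kt.1 kt.2 w).
have mg kt : measurable_fun [set: R] (g kt).
  apply: measurableT_comp => //; apply: measurable_funB => //.
  by apply: measurable_funM => //; exact: measurable_funB.
have hU S (B : set R) : measurable B -> history r sel t (U S @^-1` B).
  move=> mB.
  have mU : measurable_fun [set: g_sigma_algebraType (history_gen t)] (U S).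
    apply: measurable_funM.
      apply: measurableT_comp => //.
      exact: measurable_history_log_martingale.
    (* a polynomial expression makes the measurability of the event evident *)
    have -> : (fun w => (sset w == S)%:R : R) =
      (fun w => \prod_(j <- enum 'I_M)
         (1 - ((sel j t w == i)%:R - (j \in S)%:R) ^+ 2)).
      apply/funext => w; case: eqP => [<-|/eqP neq].
        by rewrite big1 // => j _; rewrite inE subrr expr0n subr0.
      have [j jS] : exists j, (j \in sset w) != (j \in S).
        apply/existsP; apply: contraNT neq; rewrite negb_exists => /forallP H.
        by apply/eqP/setP => j; have := H j; rewrite negbK => /eqP.
      rewrite big_enum (bigD1 j) //= -[RHS]/(_ * _); apply/esym.
      move: jS; rewrite inE; case: (sel j t w == i); case: (j \in S) => //= _.
        by rewrite subr0 expr1n subrr mul0r.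
      by rewrite sub0r sqrrN expr1n subrr mul0r.
    apply: measurable_prod => j _; apply: measurable_funB => //.
    apply: measurable_funX; apply: measurable_funB => //.
    by apply: measurable_history_sel; rewrite leqnn.
  by have := mU measurableT B mB; rewrite setTI.
have mU S : measurable_fun [set: Omega] (U S).
  move=> _ B mB; rewrite setTI; apply: (@history_measurable t).
  exact: hU.
have U0 S w : 0 <= U S w by rewrite mulr_ge0 ?expR_ge0.
have V0 S w : 0 <= V S w by rewrite prodr_ge0 // => kt _; exact: expR_ge0.
have mV S : measurable_fun [set: Omega] (V S).
  by apply: measurable_prod => kt _; apply: measurableT_comp.
have hV S (B : set R) : measurable B -> rewards_at r t (V S @^-1` B).
  move=> mB.
  have mVr : measurable_fun [set: g_sigma_algebraType (rewards_gen t)] (V S).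
    apply: measurable_prod => kt /mapP[j _ ->]; apply: measurableT_comp => //.
    move=> _ C mC; rewrite setTI; apply: sub_gen_smallest.
    by exists i, j, C.
  by have := mVr measurableT B mB; rewrite setTI.
have eVex S : exists2 e : R, e <= 1 & (\int[Pr]_w (V S w)%:E = e%:E)%E.
  pose e kt := fine (\int[Pr]_w (g kt (r i kt.1 kt.2 w))%:E)%E.
  have bnd kt : (0 < kt.2)%N ->
      (0 <= \int[Pr]_w (g kt (r i kt.1 kt.2 w))%:E <= 1)%E.
    move=> t0; rewrite integral_ge0 /=; last first.
      by move=> w _; rewrite lee_fin expR_ge0.
    by apply: subgaussian_exp_centered; [exact: mr|exact: sg].
  have eE kt : (0 < kt.2)%N ->
      (\int[Pr]_w (g kt (r i kt.1 kt.2 w))%:E = (e kt)%:E)%E.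
    move=> t0; rewrite /e fineK // ge0_fin_numE; last by case/andP: (bnd kt t0).
    by case/andP: (bnd kt t0) => _ /le_lt_trans; apply; rewrite ltry.
  exists (\prod_(kt <- [seq (j, t) | j <- enum S]) e kt); last first.
    apply: (expectation_prod_independent (ind i) (fun kt => mr i kt.1 kt.2)
      mg (fun _ _ => expR_ge0 _) eE).
      by rewrite map_inj_uniq ?enum_uniq // => a b [].
    by apply/allP => kt /mapP[j _ ->].
  rewrite big_map prodr_ile1 // => j _.
  by have := bnd (j, t) isT; rewrite eE // !lee_fin.
have step w : expR (log_martingale n.+1 w) = \sum_S V S w * U S w.
  rewrite (bigD1 (sset w)) //= big1 ?addr0; last first.
    by move=> S Sne; rewrite /U eq_sym (negbTE Sne) !mulr0.
  rewrite /U eqxx mulr1 mulrC /log_martingale big_ord_recr /= expRD.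
  congr (_ * _); rewrite expR_sum /V big_map big_enum /=.
  rewrite (bigID (mem (sset w))) /= [X in _ * X]big1 ?mulr1; last first.
    by move=> j; rewrite inE => /negbTE ->; rewrite mul0r expR0.
  by apply: eq_bigr => j; rewrite inE => ->; rewrite mul1r.
have stepU w : expR (log_martingale n w) = \sum_S U S w.
  rewrite (bigD1 (sset w)) //= big1 ?addr0; last first.
    by move=> S Sne; rewrite /U eq_sym (negbTE Sne) !mulr0.
  by rewrite /U eqxx mulr1.
apply: le_trans IH.
under eq_integral do rewrite step -sumEFin.
under [leRHS]eq_integral do rewrite stepU -sumEFin.
rewrite ge0_integral_sum //; last 2 first.
- by move=> S; apply/measurable_EFinP; exact: measurable_funM.
- by move=> S w _; rewrite lee_fin mulr_ge0.
rewrite ge0_integral_sum //; last 2 first.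
- by move=> S; apply/measurable_EFinP.
- by move=> S w _; rewrite lee_fin.
apply: lee_sum => S _.
have [e e1 eE] := eVex S.
rewrite (expectationM_independent_classes (indc t isT) (mU S) (mV S)
  (U0 S) (V0 S) (hU S) (hV S) eE).
rewrite -[leRHS]mul1e lee_wpmul2r // ?lee_fin //.
by apply: integral_ge0 => w _; rewrite lee_fin.
Qed.

End ExpSupermartingale.

(** * Series and elementary inequalities *)

Section RealBounds.
Context (R : realType).
Implicit Types (a g x y : R) (n s : nat).

Lemma ln_succ_sub_le n : (0 < n)%N -> ln (n.+1%:R) - ln (n%:R) <= (n%:R)^-1 :> R.
Proof.
move=> n0; have n0' : 0 < n%:R :> R by rewrite ltr0n.
have n1' : 0 < n.+1%:R :> R by rewrite ltr0n.
rewrite -ln_div ?posrE //.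
have -> : n.+1%:R / n%:R = 1 + (n%:R)^-1 :> R.
  by rewrite -natr1 mulrDl divff ?gt_eqF // mul1r.
apply: le_ln1Dx; apply: lt_le_trans (ltrN10 _) _.
by rewrite invr_ge0 ltW.
Qed.

Lemma ln_succ_sub_ge n : (0 < n)%N -> (n.+1%:R)^-1 <= ln (n.+1%:R) - ln (n%:R) :> R.
Proof.
move=> n0; have n0' : 0 < n%:R :> R by rewrite ltr0n.
have n1' : 0 < n.+1%:R :> R by rewrite ltr0n.
rewrite -[leRHS]opprB -ln_div ?posrE // lerNr.
have -> : n%:R / n.+1%:R = 1 + (- (n.+1%:R)^-1) :> R.
  rewrite -[in LHS](addrK 1 n%:R) natr1 mulrBl divff ?gt_eqF // mul1r //.
apply: le_ln1Dx; rewrite ltrN2 invf_lt1 // ltr1n ltnS //.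
Qed.

Lemma expR_Nln (x : R) : 0 < x -> expR (- ln x) = x^-1.
Proof. by move=> x0; rewrite expRN lnK ?posrE. Qed.

(** With [a = g - 1], the summand is at most [(t s.-1 - t s) / a] where
[t s = exp (- a ln s)], so the sum telescopes. *)
Lemma sum_expN_ln_le g n : 1 < g ->
  \sum_(2 <= s < n.+1) expR (- g * ln s%:R) <= (g - 1)^-1.
Proof.
move=> g1; set a := g - 1; have a0 : 0 < a by rewrite subr_gt0.
have ai0 : 0 < a^-1 by rewrite invr_gt0.
have [n0|n0] := posnP n; first by rewrite n0 big_geq // ltW.
suff : \sum_(2 <= s < n.+1) expR (- g * ln s%:R)
        <= a^-1 * (1 - expR (- a * ln n%:R)).
  move=> /le_trans; apply; rewrite -[leRHS]mulr1 ler_wpM2l ?(ltW ai0) //.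
elim: n n0 => // n IH _; have [->|n0] := posnP n.
  by rewrite big_geq // ln1 mulr0 expR0 subrr mulr0.
rewrite big_nat_recr //=; apply: le_trans (lerD (IH n0) (lexx _)) _.
rewrite -lerBrDl -mulrBr; pose rho : R := ln n.+1%:R - ln n%:R.
have -> : 1 - expR (- a * ln n.+1%:R) - (1 - expR (- a * ln n%:R)) =
          expR (- a * ln n.+1%:R) * (expR (a * rho) - 1) :> R.
  by rewrite mulrBr mulr1 -expRD (_ : - a * _ + a * rho = - a * ln n%:R);
    [lra|rewrite /rho; ring].
have -> : expR (- g * ln n.+1%:R) = expR (- a * ln n.+1%:R) * (n.+1%:R)^-1 :> R.
  by rewrite -expR_Nln ?ltr0n // -expRD; congr expR; rewrite /a; ring.
rewrite mulrCA ler_wpM2l ?expR_ge0 // ler_pdivlMl //.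
apply: (@le_trans _ _ (a * rho)).
  by rewrite ler_wpM2l ?(ltW a0) // ln_succ_sub_ge.
by rewrite lerBrDl expR_ge1Dx.
Qed.

(** The summand increases at first and then decreases, so it is not dominated by
the integral over the previous unit interval.  The potential [Phi] has
derivative [- ln x * x^(- g)] apart from its term [1 / s], which absorbs the
difference between [ln s] and [ln (s - 1)]; its value at 1 is the bound. *)
Lemma sum_ln_expN_ln_le g n : 1 < g ->
  \sum_(2 <= s < n.+1) ln s%:R * expR (- g * ln s%:R) <= ((g - 1) ^+ 2)^-1 + 1.
Proof.
move=> g1; set a := g - 1; have a0 : 0 < a by rewrite subr_gt0.
have ai0 : 0 < (a ^+ 2)^-1 by rewrite invr_gt0 exprn_gt0.
have [n0|n0] := posnP n; first by rewrite n0 big_geq // addr_ge0 // ltW.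
pose Phi (s : nat) : R :=
  (a ^+ 2)^-1 * (expR (- a * ln s%:R) * (a * ln s%:R + 1)) + (s%:R)^-1.
have lnn0 s : 0 <= ln s%:R :> R.
  by case: s => [|s]; [rewrite ln0|rewrite ln_ge0 // ler1n].
suff : \sum_(2 <= s < n.+1) ln s%:R * expR (- g * ln s%:R)
        <= (a ^+ 2)^-1 + 1 - Phi n.
  move=> /le_trans; apply; rewrite gerBl /Phi addr_ge0 ?invr_ge0 //.
  by rewrite mulr_ge0 ?(ltW ai0) // mulr_ge0 ?expR_ge0 // addr_ge0 // mulr_ge0 // ltW.
elim: n n0 => // n IH _; have [->|n0] := posnP n.
  by rewrite big_geq // /Phi ln1 !mulr0 expR0 add0r !mulr1 invr1 subrr.
rewrite big_nat_recr //=; apply: le_trans (lerD (IH n0) (lexx _)) _.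
suff : ln n.+1%:R * expR (- g * ln n.+1%:R) <= Phi n - Phi n.+1 by lra.
pose rho : R := ln n.+1%:R - ln n%:R.
have n0' : 0 < n%:R :> R by rewrite ltr0n.
have n1' : 0 < n.+1%:R :> R by rewrite ltr0n.
pose E := expR (- a * ln n.+1%:R) : R.
have E0 : 0 <= E by exact: expR_ge0.
have EN : expR (- a * ln n%:R) = E * expR (a * rho) :> R.
  by rewrite -expRD; congr expR; rewrite /rho; ring.
have Eg : expR (- g * ln n.+1%:R) = E * (n.+1%:R)^-1 :> R.
  by rewrite -expR_Nln ?ltr0n // -expRD; congr expR; rewrite /a; ring.
have rho0 : (n.+1%:R)^-1 <= rho by exact: ln_succ_sub_ge.
have rho1 : rho <= (n%:R)^-1 by exact: ln_succ_sub_le.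
have E1 : E <= 1.
  by rewrite -expR0 ler_expR mulNr oppr_le0 mulr_ge0 // ltW.
(* with [y = a * rho]: the nonnegative quantity [e^y - 1 - y] can be dropped,
   which leaves [(e^y - 1) * (a * ln n) >= y * (a * ln n)] *)
have main : (n.+1%:R)^-1 * ln n%:R <=
     (a ^+ 2)^-1 * (expR (a * rho) * (a * ln n%:R + 1) - (a * ln n.+1%:R + 1)).
  have -> : a * ln n.+1%:R + 1 = a * ln n%:R + a * rho + 1 by rewrite /rho; ring.
  rewrite ler_pdivlMl ?exprn_gt0 //.
  have e1 : 1 + a * rho <= expR (a * rho) by exact: expR_ge1Dx.
  have : a ^+ 2 * ((n.+1%:R)^-1 * ln n%:R) <= (a * rho) * (a * ln n%:R).
    rewrite (_ : a * rho * _ = a ^+ 2 * (rho * ln n%:R)); last by ring.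
    by rewrite ler_wpM2l ?exprn_ge0 ?(ltW a0) // ler_wpM2r.
  move=> /le_trans; apply.
  have : (1 + a * rho) * (a * ln n%:R) <= expR (a * rho) * (a * ln n%:R).
    by rewrite ler_wpM2r // mulr_ge0 // ltW.
  by move: e1; lra.
(* the error of replacing [ln n.+1] by [ln n], paid by the term [1 / s] of [Phi] *)
have small : E * (n.+1%:R)^-1 * rho <= (n%:R)^-1 - (n.+1%:R)^-1.
  apply: (@le_trans _ _ ((n.+1%:R)^-1 * (n%:R)^-1)).
    rewrite ler_pM ?mulr_ge0 ?invr_ge0 //.
      by apply: le_trans rho0; rewrite invr_ge0.
    by rewrite ler_piMl // invr_ge0.
  rewrite le_eqVlt; apply/orP; left; apply/eqP.
  have -> : n.+1%:R = n%:R + 1 :> R by rewrite natr1.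
  by field; rewrite natr1 (gt_eqF n0') (gt_eqF n1').
have main2 := ler_wpM2l E0 main.
have lnE : ln n.+1%:R = ln n%:R + rho by rewrite /rho; ring.
rewrite Eg /Phi EN -/E lnE; move: main2 small; rewrite lnE.
move: (E) (expR (a * rho)) (ln n%:R) (n%:R)^-1 (n.+1%:R)^-1 => F x l i j.
move: (rho) (a ^+ 2)^-1 (a) => y b c h1 h2.
lra.
Qed.

Lemma count_nat_lt_le x n :
  \sum_(2 <= s < n.+1) ((s%:R < x)%R)%:R <= Num.max 0 (x - 1).
Proof.
have [n1|n1] := ltnP n 2; first by rewrite big_geq // le_max lexx.
elim: n n1 => // n IH n1.
rewrite big_nat_recr //=; case: ltP => xn; last first.
  rewrite addr0; have [n2|n2] := ltnP n 2; last exact: IH.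
  by rewrite big_geq // le_max lexx.
rewrite le_max; apply/orP; right.
apply: (@le_trans _ _ (n.+1%:R - 1)); last by rewrite lerD2r ltW.
rewrite -natr1 addrK -[leRHS](subrK 1) lerD2r.
apply: (@le_trans _ _ (\sum_(2 <= s < n.+1) 1)).
  by apply: ler_sum => s _; case: ltP.
by rewrite sumr_const_nat subSS natrB.
Qed.

Lemma sqr_lt_root (q p x : R) : 0 <= q -> 0 <= p ->
  x ^+ 2 < 2 * q * x + p -> x < q + Num.sqrt (q ^+ 2 + p).
Proof.
move=> q0 p0 h; rewrite -ltrBlDl.
have [neg|pos] := ltP (x - q) 0.
  by apply: lt_le_trans neg _; exact: sqrtr_ge0.
rewrite -(ger0_norm pos) -sqrtr_sqr ltr_sqrt; last by nra.
nra.
Qed.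

End RealBounds.

(** * The consensus matrix and its spectrum *)

Section Spectral.
Context (R : realType) (M : nat).

(** A contribution made at round [s + 1] has been averaged [t - s] times by
round [t], because the averaging step also applies to the current input. *)
Lemma coop_estimateE (P : 'M[R]_M) (x : nat -> 'cV[R]_M) t k :
  coop_estimate P x t k 0 =
  \sum_(s < t) \sum_(j < M) (P ^+ (t - s)) k j * x s.+1 j 0.
Proof.
suff -> : coop_estimate P x t = \sum_(s < t) (P ^+ (t - s)) *m x s.+1.
  by rewrite summxE; apply: eq_bigr => s _; rewrite mxE.
elim: t => [|t IH] /=; first by rewrite big_ord0.
rewrite big_ord_recr /= subSnn expr1 mulmxDr IH mulmx_sumr; congr (_ + _).
apply: eq_bigr => s _; rewrite mulmxA; congr (_ *m _).
by rewrite subSn ?exprS // ltnW.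
Qed.

Lemma geometric_sum_le (y : R) t : 0 <= y < 1 ->
  \sum_(s < t) y ^+ (t - s) <= y / (1 - y).
Proof.
move=> /andP[y0 y1]; have y1' : 0 < 1 - y by rewrite subr_gt0.
rewrite ler_pdivlMr //.
suff -> : (\sum_(s < t) y ^+ (t - s)) * (1 - y) = y * (1 - y ^+ t).
  by rewrite ler_piMr // gerBl exprn_ge0.
elim: t => [|t IH]; first by rewrite big_ord0 mul0r expr0 subrr mulr0.
rewrite big_ord_recr /= subSnn expr1.
rewrite (eq_bigr (fun s : 'I_t => y * y ^+ (t - s))) => [|s _]; last first.
  by rewrite -exprS subSn // ltnW.
rewrite -mulr_sumr mulrDl -mulrA IH exprS; ring.
Qed.

Section Stochastic.
Variables (e : rel 'I_M) (kappa : R).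
Hypotheses (he : connected_graph e) (hkappa : 0 < kappa <= 1).
Let P := consensus_matrix e kappa.

Lemma consensus_matrix_ge0 k j : 0 <= P k j.
Proof.
have [esym eirr _] := he; have /andP[k0 k1] := hkappa.
have c0 : 0 <= kappa / (max_degree e)%:R by rewrite divr_ge0 // ltW.
rewrite /P /consensus_matrix !mxE; have [<-|kj] := eqVneq k j; last first.
  rewrite !mulr0n sub0r add0r mulrN opprK mulr_ge0 //.
rewrite mulr1n mulr1n eirr subr0 subr_ge0.
have dk : (degree e k <= max_degree e)%N by exact: leq_bigmax.
have [d0|d0] := posnP (max_degree e); first by rewrite d0 invr0 mulr0 mul0r ler01.
rewrite mulrAC ler_pdivrMr ?ltr0n // mul1r.
by rewrite (le_trans (ler_piMl _ k1)) ?ler_nat.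
Qed.

Lemma consensus_matrix_row_sum k : \sum_j P k j = 1.
Proof.
rewrite /P /consensus_matrix.
under eq_bigr do rewrite !mxE.
rewrite big_split /= sumrN -mulr_sumr sumrB.
have sumk (c : R) : \sum_j c *+ (k == j) = c.
  rewrite (bigD1 k) //= eqxx big1 ?addr0 // => j jk.
  by rewrite eq_sym (negbTE jk).
rewrite !sumk.
have -> : \sum_j (e k j)%:R = (degree e k)%:R :> R.
  rewrite /degree -sum1_card natr_sum [RHS]big_mkcond /=.
  by apply: eq_bigr => j _; rewrite inE; case: (e k j).
by rewrite subrr mulr0 subr0.
Qed.

Lemma coop_estimate_ge0 (x : nat -> 'cV[R]_M) t k :
  (forall s j, 0 <= x s j 0) -> 0 <= coop_estimate P x t k 0.
Proof.
move=> x0; elim: t k => [|t IH] k /=; first by rewrite mxE.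
rewrite mxE sumr_ge0 // => j _; rewrite mulr_ge0 ?consensus_matrix_ge0 //.
by rewrite mxE addr_ge0.
Qed.

Lemma coop_estimate_le (x : nat -> 'cV[R]_M) t k :
  (forall s j, x s j 0 <= 1) -> coop_estimate P x t k 0 <= t%:R.
Proof.
move=> x1; elim: t k => [|t IH] k /=; first by rewrite mxE.
rewrite mxE -[leRHS]mul1r -[X in _ <= X * _](consensus_matrix_row_sum k) mulr_suml.
apply: ler_sum => j _; rewrite ler_wpM2l ?consensus_matrix_ge0 //.
by rewrite mxE -natr1 lerD.
Qed.

(** Averaging with a stochastic matrix preserves the lower bound 1 once every
agent has contributed 1 in the same round. *)
Lemma coop_estimate_ge1 (x : nat -> 'cV[R]_M) t0 t k :
  (forall s j, 0 <= x s j 0) -> (forall j, x t0.+1 j 0 = 1) -> (t0 < t)%N ->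
  1 <= coop_estimate P x t k 0.
Proof.
move=> x0 xt0; elim: t k => // t IH k; rewrite ltnS => t0t /=.
rewrite mxE -(consensus_matrix_row_sum k).
apply: ler_sum => j _; rewrite -[leLHS]mulr1 ler_wpM2l ?consensus_matrix_ge0 //.
rewrite mxE; move: t0t; rewrite leq_eqVlt => /predU1P[<-|t0t].
  by rewrite xt0 lerDr coop_estimate_ge0.
by rewrite -[leLHS]addr0 lerD // IH.
Qed.

End Stochastic.

Section Eigenbasis.
Variables (P : 'M[R]_M) (lambda : 'I_M -> R) (u : 'I_M -> 'cV[R]_M).
Hypotheses (hM : (0 < M)%N) (hspec : ordered_eigenbasis P lambda u)
  (hlambda : forall p : 'I_M, (0 < p)%N -> -1 < lambda p < 1).

Lemma eigenbasis_powE a k j :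
  (P ^+ a) k j = \sum_(p < M) lambda p ^+ a * (u p k 0 * u p j 0).
Proof.
have [eig orth _ _] := hspec.
pose U : 'M[R]_M := \matrix_(k, p) u p k 0.
have UTU : U^T *m U = 1%:M.
  apply/matrixP => p q; rewrite !mxE -orth; apply: eq_bigr => d _.
  by rewrite !mxE.
have UUT : U *m U^T = 1%:M by exact: mulmx1C.
elim: a k j => [|a IH] k j.
  rewrite expr0 -[1]/(1%:M) -UUT mxE; apply: eq_bigr => p _.
  by rewrite !mxE mul1r.
rewrite exprS mxE.
under eq_bigr => i _ do rewrite IH mulr_sumr.
rewrite exchange_big /=; apply: eq_bigr => p _.
have := congr1 (fun v : 'cV_M => v k 0) (eig p); rewrite !mxE => E.
have -> : lambda p ^+ a.+1 * (u p k 0 * u p j 0) =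
    lambda p ^+ a * u p j 0 * (lambda p * u p k 0) by rewrite exprSr; ring.
rewrite -E mulr_sumr.
by apply: eq_bigr => i _; ring.
Qed.

Lemma eigenvalue_abs_lt1 (p : 'I_M) : (0 < p)%N -> `|lambda p| < 1.
Proof. by move=> /hlambda; rewrite ltr_norml. Qed.

Lemma leading_eigenpair (p : 'I_M) : ~~ (0 < p)%N ->
  lambda p = 1 /\ forall k, u p k 0 = (Num.sqrt M%:R)^-1.
Proof.
rewrite lt0n negbK => /eqP p0; have [_ _ _ /(_ p p0)[-> ->]] := hspec.
by split => // k; rewrite mxE.
Qed.

Lemma eigenvalue_abs_le1 (p : 'I_M) : `|lambda p| <= 1.
Proof.
have [p0|/leading_eigenpair[-> _]] := boolP (0 < p)%N; last by rewrite normr1.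
by rewrite ltW // eigenvalue_abs_lt1.
Qed.

Lemma eigenvalueM_abs_lt1 (p q : 'I_M) : (0 < q)%N -> 0 <= `|lambda p * lambda q| < 1.
Proof.
move=> q0; rewrite normr_ge0 /= normrM.
apply: le_lt_trans (eigenvalue_abs_lt1 q0); rewrite -[leRHS]mul1r.
by rewrite ler_wpM2r // eigenvalue_abs_le1.
Qed.

Lemma sqrtM_gt0 : 0 < Num.sqrt M%:R :> R.
Proof. by rewrite sqrtr_gt0 ltr0n. Qed.

Lemma sqrtM_sqr : (Num.sqrt M%:R)^-1 * (Num.sqrt M%:R)^-1 = (M%:R)^-1 :> R.
Proof. by rewrite -invfM -expr2 sqr_sqrtr. Qed.

(** The leading eigenvalue 1 has the constant eigenvector: its term is the exact
average over the agents, and all the other terms decay. *)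
Lemma sum_split_leading (F : 'I_M -> R) :
  \sum_(p < M) F p = F (Ordinal hM) + \sum_(p < M | (0 < p)%N) F p.
Proof.
rewrite (bigID (fun p : 'I_M => (0 < p)%N)) /= addrC; congr (_ + _).
rewrite (big_pred1 (Ordinal hM)) // => p.
by rewrite -leqNgt leqn0.
Qed.

Lemma eigenbasis_pow_split a k j :
  (P ^+ a) k j = (M%:R)^-1 +
    \sum_(p < M | (0 < p)%N) lambda p ^+ a * (u p k 0 * u p j 0).
Proof.
rewrite eigenbasis_powE sum_split_leading; congr (_ + _).
have [-> E] := @leading_eigenpair (Ordinal hM) isT.
by rewrite !E expr1n mul1r sqrtM_sqr.
Qed.

Lemma eigenbasis_pow_sqr_split a k j :
  (P ^+ a) k j ^+ 2 = (P ^+ a) k j / M%:R +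
    \sum_(p < M) \sum_(q < M | (0 < q)%N)
      (lambda p * lambda q) ^+ a * (u p k 0 * u q k 0) * (u p j 0 * u q j 0).
Proof.
rewrite {1}eigenbasis_powE expr2 mulr_suml eigenbasis_powE mulr_suml -big_split.
apply: eq_bigr => p _ /=; rewrite [in LHS](sum_split_leading) mulrDr; congr (_ + _).
  have [-> E] := @leading_eigenpair (Ordinal hM) isT.
  by rewrite !E expr1n mul1r sqrtM_sqr.
by rewrite mulr_sumr; apply: eq_bigr => q _; rewrite exprMn; ring.
Qed.

Lemma eigenvector_abs_le1 p k : `|u p k 0| <= 1.
Proof.
have [_ orth _ _] := hspec.
have := orth p p; rewrite eqxx mulr1n (bigD1 k) //= => E.
have : u p k 0 ^+ 2 <= 1.
  by rewrite -E expr2 lerDl sumr_ge0 // => j _; rewrite -expr2 sqr_ge0.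
by rewrite -real_normK ?num_real // expr_le1.
Qed.

(** Cauchy-Schwarz against the constant vector, as the arithmetic-geometric mean
inequality [2 * x <= c * x^2 + 1 / c] summed with [c = sqrt M]. *)
Lemma eigenvector_abs_sum_le p : \sum_(j < M) `|u p j 0| <= Num.sqrt M%:R.
Proof.
have [_ orth _ _] := hspec; have c0 := sqrtM_gt0; set c := Num.sqrt _ in c0 *.
have cM : c ^+ 2 = M%:R by rewrite sqr_sqrtr.
apply: (@le_trans _ _ (\sum_(j < M) ((c * (u p j 0 * u p j 0) + c^-1) / 2))).
  apply: ler_sum => j _; rewrite ler_pdivlMr // -expr2.
  rewrite -[u p j 0 ^+ 2]real_normK ?num_real //.
  have : 0 <= c^-1 * (c * `|u p j 0| - 1) ^+ 2.
    by rewrite mulr_ge0 ?sqr_ge0 // invr_ge0 ltW.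
  have -> : c^-1 * (c * `|u p j 0| - 1) ^+ 2 =
    c * `|u p j 0| ^+ 2 + c^-1 - `|u p j 0| * 2 by field; rewrite gt_eqF.
  by rewrite subr_ge0.
rewrite -mulr_suml big_split /= -mulr_sumr orth eqxx mulr1n sumr_const card_ord.
rewrite -[_ *+ M]mulr_natr -cM.
by rewrite le_eqVlt; apply/orP; left; apply/eqP; field; rewrite gt_eqF.
Qed.

Section Estimates.
Variables (x : nat -> 'cV[R]_M) (t : nat) (k : 'I_M).
Hypothesis x01 : forall s j, 0 <= x s j 0 <= 1.

Lemma coop_estimate_mean_dist :
  `|coop_estimate P x t k 0 - (\sum_(s < t) \sum_(j < M) x s.+1 j 0) / M%:R|
    <= graph_explore_exploit_index lambda.
Proof.
rewrite coop_estimateE.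
have -> : \sum_(s < t) \sum_(j < M) (P ^+ (t - s)) k j * x s.+1 j 0
    - (\sum_(s < t) \sum_(j < M) x s.+1 j 0) / M%:R =
  \sum_(p < M | (0 < p)%N) \sum_(s < t)
     lambda p ^+ (t - s) * (u p k 0 * \sum_(j < M) u p j 0 * x s.+1 j 0).
  rewrite [RHS]exchange_big /= mulr_suml -sumrB; apply: eq_bigr => s _.
  rewrite mulr_suml -sumrB.
  transitivity (\sum_(j < M) \sum_(p < M | (0 < p)%N)
      lambda p ^+ (t - s) * (u p k 0 * u p j 0) * x s.+1 j 0).
    apply: eq_bigr => j _; rewrite eigenbasis_pow_split -mulr_suml; ring.
  rewrite exchange_big /=; apply: eq_bigr => p _.
  by rewrite !mulr_sumr; apply: eq_bigr => j _; ring.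
rewrite /graph_explore_exploit_index mulr_sumr.
apply: le_trans (ler_norm_sum _ _ _) _; apply: ler_sum => p p0.
apply: le_trans (ler_norm_sum _ _ _) _.
have lam : 0 <= `|lambda p| < 1 by rewrite normr_ge0 eigenvalue_abs_lt1.
apply: le_trans (ler_wpM2l (ltW sqrtM_gt0) (geometric_sum_le t lam)).
rewrite mulr_sumr; apply: ler_sum => s _.
rewrite normrM normrX [leRHS]mulrC ler_wpM2l ?exprn_ge0 //.
rewrite normrM -[leRHS]mul1r ler_pM ?normr_ge0 ?eigenvector_abs_le1 //.
apply: le_trans (ler_norm_sum _ _ _) _.
apply: le_trans (eigenvector_abs_sum_le p); apply: ler_sum => j _.
have /andP[xj0 xj1] := x01 s.+1 j.
by rewrite normrM (ger0_norm xj0) ler_piMr.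
Qed.

Lemma nu_bounds p q s :
  nu_minus_sum u p q <= \sum_(j < M) u p j 0 * u q j 0 * x s j 0
    <= nu_plus_sum u p q.
Proof.
rewrite /nu_minus_sum /nu_plus_sum !(big_mkcond (fun d => _ <= _)) /=.
apply/andP; split; apply: ler_sum => j _; have /andP[xj0 xj1] := x01 s j;
  move: (u p j 0 * u q j 0) => v.
- by case: (leP v 0) => h; [rewrite ler_niMr | rewrite mulr_ge0 // ltW].
- by case: (leP 0 v) => h; [rewrite ler_piMr | rewrite mulr_le0_ge0 // ltW].
Qed.

Lemma nodal_coef_ge0 p q : 0 <= nodal_coef lambda u k p q.
Proof.
have np : 0 <= nu_plus_sum u p q by rewrite sumr_ge0.
have nm : nu_minus_sum u p q <= 0.
  by rewrite -oppr_ge0 -sumrN sumr_ge0 // => j; rewrite oppr_ge0.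
rewrite /nodal_coef; case: ifP => _; last by rewrite mulr_ge0 // le_max normr_ge0.
case: (leP 0 (u p k 0 * u q k 0)) => h; first by rewrite mulr_ge0.
by rewrite mulr_le0 // ltW.
Qed.

(** The three cases in the definition of [nodal_coef] are the three sign patterns
for which the middle factor, known only to lie between [nu_minus_sum] and
[nu_plus_sum], is replaced by its worst value; a negative [lambda p * lambda q]
gives powers of alternating sign, hence [nu_max]. *)
Lemma nodal_coef_bound p q s a :
  (lambda p * lambda q) ^+ a * (u p k 0 * u q k 0)
     * (\sum_(j < M) u p j 0 * u q j 0 * x s j 0)
  <= `|lambda p * lambda q| ^+ a * nodal_coef lambda u k p q.
Proof.
have /andP[ylo yhi] := nu_bounds p q s.
rewrite /nodal_coef; set y := \sum_(j < M) _ in ylo yhi *.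
set v := u p k 0 * _; set l := lambda p * _.
case: (leP 0 l) => hl.
  rewrite (ger0_norm hl) -mulrA ler_wpM2l ?exprn_ge0 //.
  by case: (leP 0 v) => hv; nra.
apply: le_trans (ler_norm _) _; rewrite -mulrA [leLHS]normrM normrX.
rewrite ler_wpM2l ?exprn_ge0 // [leLHS]normrM mulrC ler_wpM2r //.
rewrite /nu_max le_max; apply/orP.
have [y0|y0] := leP 0 y; first by right; rewrite ger0_norm.
by left; rewrite ltr0_norm // ler0_norm ?lerN2 // (le_trans ylo) // ltW.
Qed.

(** In the double expansion of the squared weights, the terms with a leading second
factor add up to the weights themselves divided by [M], that is to
[n_hat / M]; the others are geometric series in [s], and their sum is the nodal
index. *)
Lemma coop_estimate_variance :
  \sum_(s < t) \sum_(j < M) (P ^+ (t - s)) k j ^+ 2 * x s.+1 j 0 <=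
  (coop_estimate P x t k 0 + nodal_explore_exploit_index lambda u k) / M%:R.
Proof.
have M0 : M%:R != 0 :> R by rewrite pnatr_eq0 -lt0n.
rewrite mulrDl [X in _ + X]mulrAC divff // mul1r coop_estimateE.
have -> : \sum_(s < t) \sum_(j < M) (P ^+ (t - s)) k j ^+ 2 * x s.+1 j 0 =
  (\sum_(s < t) \sum_(j < M) (P ^+ (t - s)) k j * x s.+1 j 0) / M%:R +
  \sum_(p < M) \sum_(q < M | (0 < q)%N) \sum_(s < t)
    (lambda p * lambda q) ^+ (t - s) * (u p k 0 * u q k 0)
     * (\sum_(j < M) u p j 0 * u q j 0 * x s.+1 j 0).
  under [X in _ = _ + X]eq_bigr do rewrite exchange_big.
  rewrite [X in _ = _ + X]exchange_big /= mulr_suml -big_split.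
  apply: eq_bigr => s _ /=; rewrite mulr_suml.
  under [X in _ = _ + X]eq_bigr => p _ do under eq_bigr => q _ do rewrite mulr_sumr.
  under [X in _ = _ + X]eq_bigr do rewrite exchange_big.
  rewrite [X in _ = _ + X]exchange_big /= -big_split; apply: eq_bigr => j _ /=.
  rewrite eigenbasis_pow_sqr_split mulrDl; congr (_ + _); first by ring.
  rewrite mulr_suml; apply: eq_bigr => p _.
  by rewrite mulr_suml; apply: eq_bigr => q _; ring.
rewrite lerD2l; apply: ler_sum => p _; apply: ler_sum => q q0.
have l1 := eigenvalueM_abs_lt1 p q0.
apply: le_trans (ler_wpM2r (nodal_coef_ge0 p q) (geometric_sum_le t l1)).
by rewrite mulr_suml; apply: ler_sum => s _; exact: nodal_coef_bound.
Qed.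

End Estimates.

Lemma graph_explore_exploit_index_ge0 : 0 <= graph_explore_exploit_index lambda.
Proof.
rewrite mulr_ge0 ?sqrtr_ge0 // sumr_ge0 // => p p0.
by rewrite divr_ge0 // subr_ge0 ltW // eigenvalue_abs_lt1.
Qed.

Lemma nodal_explore_exploit_index_ge0 k :
  0 <= nodal_explore_exploit_index lambda u k.
Proof.
rewrite mulr_ge0 // sumr_ge0 // => p _; rewrite sumr_ge0 // => q q0.
rewrite mulr_ge0 ?nodal_coef_ge0 // divr_ge0 // subr_ge0.
by have /andP[_ /ltW] := eigenvalueM_abs_lt1 p q0.
Qed.

End Eigenbasis.
End Spectral.

(** * Peeling over geometric bands *)

Section Peeling.
Context (R : realType).
Variables (sigma eta L w0 : R).
Hypotheses (sigma0 : 0 < sigma) (heta : 0 < eta < 4) (L0 : 0 <= L) (w00 : 0 < w0).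

Lemma G_factor_gt0 : 0 < G_factor eta.
Proof. by rewrite /G_factor; move/andP: heta => [e0 e4]; nra. Qed.

(** The exponent [b * X - sigma^2 * b^2 / 2 * W] at the threshold
[X = sigma * sqrt (2 L / G * W)] is maximal for [b] proportional to
[1 / sqrt W].  Here [sqrt W] is replaced by the geometric mean of the endpoints
of its range over the band [h]. *)
Definition tilt (h : nat) : R :=
  Num.sqrt (2 * L / G_factor eta)
  / (sigma * (Num.sqrt (w0 * (1 + eta) ^+ h) * Num.sqrt (Num.sqrt (1 + eta)))).

Lemma fourth_root_le : Num.sqrt (Num.sqrt (1 + eta)) <= 1 + eta / 4.
Proof.
have /andP[e0 e4] := heta.
have s (y : R) : 1 <= y -> forall x, 0 <= x -> x <= y ^+ 2 -> Num.sqrt x <= y.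
  move=> y1 x x0 xy; rewrite -[leRHS]ger0_norm ?(le_trans ler01) //.
  by rewrite -sqrtr_sqr ler_wsqrtr.
have y1 : 1 <= 1 + eta / 4 by lra.
apply: (s _ y1); first exact: sqrtr_ge0.
by apply: s; nra.
Qed.

Lemma fourth_root_ge1 : 1 <= Num.sqrt (Num.sqrt (1 + eta)).
Proof.
have /andP[e0 e4] := heta.
rewrite -[leLHS]sqrtr1 ler_wsqrtr // -[leLHS]sqrtr1 ler_wsqrtr //; lra.
Qed.

(** If [rho] is the ratio of [sqrt W] to its reference value, the exponent is the
optimal one multiplied by [1 - (1 - rho)^2].  On the band, [rho] lies between
[1 / q] and [q] with [q = (1 + eta)^(1/4) <= 1 + eta / 4], so the loss is at
most [eta^2 / 16]. *)
Lemma tilt_exponent (X V W : R) h :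
  w0 * (1 + eta) ^+ h <= W <= w0 * (1 + eta) ^+ h.+1 -> V <= W ->
  sigma * Num.sqrt (2 * L / G_factor eta * W) <= X ->
  L <= tilt h * X - sigma ^+ 2 * tilt h ^+ 2 / 2 * V.
Proof.
have /andP[e0 e4] := heta; have G0 := G_factor_gt0.
move=> /andP[W1 W2] VW XW.
set q := Num.sqrt (Num.sqrt (1 + eta)).
have q1 : 1 <= q by exact: fourth_root_ge1.
have qle : q <= 1 + eta / 4 by exact: fourth_root_le.
have q0 : 0 < q by apply: lt_le_trans q1.
have q4 : q ^+ 2 * q ^+ 2 = 1 + eta.
  by rewrite sqr_sqrtr ?sqrtr_ge0 // -expr2 sqr_sqrtr //; lra.
have wh0 : 0 < w0 * (1 + eta) ^+ h by rewrite mulr_gt0 // exprn_gt0 //; lra.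
set y := Num.sqrt (w0 * (1 + eta) ^+ h).
have y0 : 0 < y by rewrite sqrtr_gt0.
set delta := Num.sqrt (2 * L / G_factor eta).
have d0 : 0 <= delta by exact: sqrtr_ge0.
have LG0 : 0 <= 2 * L / G_factor eta by rewrite divr_ge0 ?mulr_ge0 // ltW.
have dL : delta ^+ 2 = 2 * L / G_factor eta by rewrite sqr_sqrtr.
set x := Num.sqrt W.
have W0 : 0 < W by exact: lt_le_trans W1.
have x0 : 0 < x by rewrite sqrtr_gt0.
have xW : x ^+ 2 = W by rewrite sqr_sqrtr // ltW.
have XW' : sigma * (delta * x) <= X by rewrite /delta /x -sqrtrM.
have yx : y <= x by rewrite ler_wsqrtr.
have xy : x <= y * q ^+ 2.
  have -> : y * q ^+ 2 = Num.sqrt (w0 * (1 + eta) ^+ h.+1).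
    rewrite /y sqr_sqrtr ?sqrtr_ge0 // -sqrtrM ?(ltW wh0) //.
    by rewrite exprS; congr Num.sqrt; ring.
  by rewrite ler_wsqrtr.
have zE : tilt h = delta / (sigma * (y * q)) by [].
set z := y * q in zE; have z0 : 0 < z by rewrite mulr_gt0.
pose rho := x / z.
have rho_le : rho <= q by rewrite /rho ler_pdivrMr // /z mulrCA -expr2.
have rho_ge : q^-1 <= rho.
  by rewrite /rho ler_pdivlMr // /z mulrC -mulrA divff ?gt_eqF // mulr1.
(* both ends of the range of [rho] are at distance at most [q - 1] from 1 *)
have qinv : 1 - q^-1 <= q - 1.
  have : 0 <= q^-1 * (q - 1) ^+ 2 by rewrite mulr_ge0 ?sqr_ge0 // invr_ge0 ltW.
  have -> : q^-1 * (q - 1) ^+ 2 = q + q^-1 - 2 by field; rewrite gt_eqF.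
  lra.
have dist : (1 - rho) ^+ 2 <= (eta / 4) ^+ 2 by nra.
have t0 : 0 <= tilt h by rewrite zE divr_ge0 // mulr_ge0 // ltW.
apply: (@le_trans _ _ (tilt h * (sigma * (delta * x))
                       - sigma ^+ 2 * tilt h ^+ 2 / 2 * W)); last first.
  apply: lerB; first by rewrite ler_wpM2l.
  by rewrite ler_wpM2l // divr_ge0 // mulr_ge0 ?sqr_ge0.
have -> : tilt h * (sigma * (delta * x)) - sigma ^+ 2 * tilt h ^+ 2 / 2 * W =
   delta ^+ 2 / 2 * (1 - (1 - rho) ^+ 2).
  by rewrite zE -xW /rho; field; rewrite !gt_eqF.
have -> : L = delta ^+ 2 / 2 * G_factor eta.
  by rewrite dL; field; rewrite gt_eqF.
rewrite ler_wpM2l ?divr_ge0 ?sqr_ge0 // /G_factor.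
by move: dist; rewrite expr_div_n; lra.
Qed.

Lemma geometric_band (W : R) H : (0 < H)%N ->
  w0 <= W -> W <= w0 * (1 + eta) ^+ H ->
  exists2 h, (h < H)%N & w0 * (1 + eta) ^+ h <= W <= w0 * (1 + eta) ^+ h.+1.
Proof.
move=> + W1; elim: H => // H IH _ W2.
have [W3|W3] := leP W (w0 * (1 + eta) ^+ H); last first.
  by exists H => //; rewrite (ltW W3).
have [H0|H0] := posnP H.
  move: W3; rewrite H0 expr0 mulr1 => W3; exists 0%N => //.
  by rewrite expr0 mulr1 W1 -[in 1%N]H0.
by have [h hH hW] := IH H0 W3; exists h => //; rewrite ltnW.
Qed.

(** The event in the hypotheses is covered by the bands, and on the band [h] the
term [h] alone is at least 1.  Integrating this pointwise bound plays the part
of the union bound over the bands. *)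
Lemma one_le_sum_tilted (X V W : R) H : (0 < H)%N ->
  w0 <= W -> W <= w0 * (1 + eta) ^+ H -> V <= W ->
  sigma * Num.sqrt (2 * L / G_factor eta * W) <= X ->
  1 <= \sum_(h < H) expR (- L) *
         expR (tilt h * X - sigma ^+ 2 * tilt h ^+ 2 / 2 * V).
Proof.
move=> H0 W1 W2 VW XW.
have [h hH hW] := geometric_band H0 W1 W2.
rewrite (bigD1 (Ordinal hH)) //= -[leLHS]addr0 lerD //; last first.
  by rewrite sumr_ge0 // => i _; rewrite mulr_ge0 ?expR_ge0.
rewrite -expRD -[leLHS]expR0 ler_expR addrC subr_ge0.
exact: tilt_exponent hW VW XW.
Qed.

End Peeling.

Section Bands.
Context (R : realType).

Definition band_count (eta : R) (s : nat) : nat :=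
  (Num.truncn (ln s%:R / ln (1 + eta))).+1.

Lemma band_count_le (eta : R) s : 0 < eta -> (0 < s)%N ->
  (band_count eta s)%:R <= ln s%:R / ln (1 + eta) + 1.
Proof.
move=> e0 s0; rewrite /band_count -natr1 lerD2r.
rewrite truncn_le // divr_ge0 // ln_ge0 ?ler1n //; lra.
Qed.

Lemma band_count_exp_ge (eta : R) s : 0 < eta -> (0 < s)%N ->
  s%:R <= (1 + eta) ^+ band_count eta s.
Proof.
move=> e0 s0; have e1 : 0 < 1 + eta by lra.
have l0 : 0 < ln (1 + eta) by rewrite ln_gt0 //; lra.
rewrite -ler_ln ?posrE ?ltr0n ?exprn_gt0 // lnXn //.
rewrite -[leRHS]mulr_natl -ler_pdivrMr // ltW //.
exact: truncnS_gt.
Qed.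

(** The sum starts at 2: the missing term is the slack spent in
[regret_constant_dominates]. *)
Lemma sum_band_tail_le (eta gamma : R) n : 0 < eta -> 1 < gamma ->
  \sum_(2 <= s < n.+1) (band_count eta s)%:R * expR (- gamma * ln s%:R) <=
  (ln (1 + eta))^-1 * (((gamma - 1) ^+ 2)^-1 + 1) + (gamma - 1)^-1.
Proof.
move=> e0 g1; have l0 : 0 < ln (1 + eta) by rewrite ln_gt0 //; lra.
apply: (@le_trans _ _ (\sum_(2 <= s < n.+1)
  ((ln (1 + eta))^-1 * (ln s%:R * expR (- gamma * ln s%:R))
   + expR (- gamma * ln s%:R)))).
  rewrite big_nat_cond [leRHS]big_nat_cond; apply: ler_sum => s /andP[/andP[s2 _] _].
  rewrite mulrA -[X in _ + X]mul1r -mulrDl ler_wpM2r ?expR_ge0 //.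
  by rewrite mulrC band_count_le // (leq_trans _ s2).
rewrite big_split /= -mulr_sumr lerD ?sum_expN_ln_le //.
by rewrite ler_wpM2l ?sum_ln_expN_ln_le // invr_ge0 ltW.
Qed.
End Bands.

(** * Counting plays *)

Section Counting.
Context (R : realType) (M : nat).

(** At the last time when a counted play occurs at most [K] plays have been made
before, and that time adds at most one play per agent. *)
Lemma plays_below_threshold_le (A : nat -> 'I_M -> bool) (K : R) T : 0 <= K ->
  \sum_(t < T) \sum_(k < M)
     (A t k && (\sum_(s < t) \sum_(j < M) (A s j)%:R <= K)%R)%:R
  <= K + M%:R.
Proof.
move=> K0; elim: T => [|T IH]; first by rewrite big_ord0 addr_ge0.
rewrite big_ord_recr /=.
case: (leP (\sum_(s < T) \sum_(j < M) (A s j)%:R) K) => hK; last first.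
  by rewrite [X in _ + X]big1 ?addr0 // => k _; rewrite andbF.
rewrite lerD //.
  apply: le_trans hK; apply: ler_sum => s _; apply: ler_sum => k _.
  rewrite ler_nat. by case: (A s k) => //=; exact: leq_b1.
apply: (@le_trans _ _ (\sum_(k < M) 1)); last by rewrite sumr_const card_ord.
by apply: ler_sum => k _; rewrite andbT lern1 leq_b1.
Qed.

Lemma plays_split (A : nat -> 'I_M -> bool) (K : R) T : 0 <= K ->
  \sum_(t < T) \sum_(k < M) (A t k)%:R <=
  K + M%:R + \sum_(t < T) \sum_(k < M)
     (A t k && (K < \sum_(s < t) \sum_(j < M) (A s j)%:R)%R)%:R.
Proof.
move=> K0; apply: le_trans (lerD (plays_below_threshold_le A T K0) (lexx _)).
rewrite -big_split; apply: ler_sum => t _; rewrite -big_split.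
apply: ler_sum => k _ /=; rewrite -natrD ler_nat.
by case: leP; case: (A t k).
Qed.

End Counting.

Section Pinv.
Context (R : realType).
Variables (D : set R) (f : R -> R).
Hypothesis hf : increasing_sublogarithmic D f.

(** Both [n] and [pinv D f y] lie in [D], where [f] is strictly increasing. *)
Lemma le_of_pinv_le (y : R) (n : nat) : (f @` D) y -> (0 < n)%N ->
  pinv D f y <= n%:R -> y <= f n%:R.
Proof.
move=> fy n0; have [_ Dn mono _] := hf.
have fK : f (pinv D f y) = y by apply: pinvK; exact: mem_set.
have pD : D (pinv D f y).
  by apply: (@surjpinv_image_sub _ _ (fun=> point) D (f @` D) f) => //; exists y.
rewrite le_eqVlt => /predU1P[<-|lt]; first by rewrite fK.
by rewrite -fK ltW // mono //; apply: mem_set => //; exact: Dn.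
Qed.

Lemma pinv_gt0 (y : R) : (f @` D) y -> 0 < pinv D f y.
Proof.
have [D0 _ _ _] := hf; move=> fy; apply: D0.
by apply: (@surjpinv_image_sub _ _ (fun=> point) D (f @` D) f) => //; exists y.
Qed.

Lemma sublogarithmic_nat_homo (a b : nat) : (0 < a)%N -> (a <= b)%N -> f a%:R <= f b%:R.
Proof.
have [_ Dn mono _] := hf.
move=> a0; rewrite leq_eqVlt => /predU1P[->//|ab].
rewrite ltW // mono ?ltr_nat //; apply: mem_set; apply: Dn => //.
exact: leq_trans ab.
Qed.
End Pinv.

(** * Selections along a sample path *)

Section Paths.
Context d (Omega : measurableType d) (R : realType).
Context (M N : nat) (hM : (0 < M)%N).
Variables (e : rel 'I_M) (kappa : R).
Hypotheses (he : connected_graph e) (hkappa : 0 < kappa <= 1).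
Variables (lambda : 'I_M -> R) (u : 'I_M -> 'cV[R]_M).
Let P := consensus_matrix e kappa.
Hypotheses (hspec : ordered_eigenbasis P lambda u)
  (hlambda : forall p : 'I_M, (0 < p)%N -> -1 < lambda p < 1).
Variables (m : 'I_N -> R) (sigma : R).
Hypothesis (hsigma : 0 < sigma).
Variables (r : 'I_N -> 'I_M -> nat -> Omega -> R)
  (sel : 'I_M -> nat -> Omega -> 'I_N).
Variables (gamma eta : R).
Hypotheses (hgamma : 1 < gamma) (heta : 0 < eta < 4).
Variables (D : set R) (f : R -> R).
Hypothesis (hf : increasing_sublogarithmic D f).
Let G := G_factor eta.
Hypothesis (hpolicy : coop_UCB2_policy r sel P sigma gamma G f).

Let nh i k t w := n_hat sel P i k t w.
Let eps_n := graph_explore_exploit_index lambda.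
Let eps_c k := nodal_explore_exploit_index lambda u k.

Definition plays i t w : R := \sum_(s < t) \sum_(j < M) (sel j s.+1 w == i)%:R.

Let xi i w s : 'cV[R]_M := \col_j (sel j s w == i)%:R.

Lemma arm_indicator01 i w s j : 0 <= xi i w s j 0 <= 1.
Proof. by rewrite mxE; case: eqP; rewrite !lexx ler01. Qed.

Lemma n_hat_le i k t w : nh i k t w <= t%:R.
Proof.
by apply: coop_estimate_le => // s j; have /andP[] := arm_indicator01 i w s j.
Qed.

Lemma n_hat_ge1 i k t w : (N <= t)%N -> 1 <= nh i k t w.
Proof.
move=> Nt; apply: (@coop_estimate_ge1 _ _ e kappa he hkappa _ i) => //.
- by move=> s j; have /andP[] := arm_indicator01 i w s j.
- move=> j; rewrite mxE; have [+ _] := hpolicy j i.+1 w.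
  by rewrite ltn_ord => /(_ isT) /= E; rewrite -(inj_eq val_inj) /= E eqxx.
- exact: leq_trans Nt.
Qed.

Lemma playsE i t w : plays i t w = \sum_(s < t) \sum_(j < M) xi i w s.+1 j 0.
Proof. by apply: eq_bigr => s _; apply: eq_bigr => j _; rewrite mxE. Qed.

Lemma plays_le i k t w : plays i t w <= M%:R * (nh i k t w + eps_n).
Proof.
have := coop_estimate_mean_dist hM hspec hlambda t k (arm_indicator01 i w).
rewrite ler_norml => /andP[+ _]; rewrite -/eps_n -playsE -/(nh i k t w).
have M0 : 0 < M%:R :> R by rewrite ltr0n.
rewrite lerBrDl -lerBrDr opprK ler_pdivrMr // mulrC => /le_trans; apply.
by [].
Qed.

Definition deviation i k t w := s_hat r sel P i k t w - m i * nh i k t w.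

(** Multiplied by [sigma ^+ 2], this is the sum over the rounds of the conditional
variance proxies of the increments of [deviation]. *)
Definition quad_variation i k t w : R :=
  \sum_(s < t) \sum_(j < M) (P ^+ (t - s)) k j ^+ 2 * (sel j s.+1 w == i)%:R.

Lemma log_martingaleE b i k t w :
  log_martingale r sel m sigma i (fun s j => b * (P ^+ (t - s)) k j) t w =
  b * deviation i k t w - sigma ^+ 2 * b ^+ 2 / 2 * quad_variation i k t w.
Proof.
rewrite /deviation /nh /s_hat /n_hat !coop_estimateE /quad_variation.
rewrite [m i * _]mulr_sumr -sumrB !mulr_sumr -sumrB; apply: eq_bigr => s _.
rewrite [m i * _]mulr_sumr -sumrB !mulr_sumr -sumrB; apply: eq_bigr => j _.
by rewrite !mxE /subgaussian_increment; ring.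
Qed.

Lemma quad_variation_le i k t w :
  quad_variation i k t w <= (nh i k t w + eps_c k) / M%:R.
Proof.
apply: le_trans (coop_estimate_variance hM hspec hlambda t k (arm_indicator01 i w)).
by apply: ler_sum => s _; apply: ler_sum => j _; rewrite mxE.
Qed.

(** The sign [sgn] selects the direction of the deviation.  The base of the bands,
[(1 + f t) / M], is a lower bound for [(n_hat + f t) / M] once every arm has been
sampled, because [n_hat] is then at least 1. *)
Definition tail_bound (sgn : R) i k t w : R :=
  \sum_(h < band_count eta t) expR (- (gamma * ln t%:R)) *
    expR (log_martingale r sel m sigma i
      (fun s j => sgn * tilt sigma eta (gamma * ln t%:R) ((1 + f t%:R) / M%:R) h
                  * (P ^+ (t - s)) k j) t w).

Let width i k t w := ucb_width sel P sigma gamma G f i k t w.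

Lemma tail_bound_ge0 sgn i k t w : 0 <= tail_bound sgn i k t w.
Proof. by rewrite sumr_ge0 // => h _; rewrite mulr_ge0 ?expR_ge0. Qed.

Lemma tail_bound_ge1 sgn i k t w : sgn ^+ 2 = 1 -> (N <= t)%N -> (0 < t)%N ->
  eps_c k <= f t%:R ->
  nh i k t w * width i k t w <= sgn * deviation i k t w ->
  1 <= tail_bound sgn i k t w.
Proof.
move=> sgn2 Nt t0 ft dev.
have M0 : 0 < M%:R :> R by rewrite ltr0n.
have Mi0 : 0 < (M%:R)^-1 :> R by rewrite invr_gt0.
have n1 : 1 <= nh i k t w by exact: n_hat_ge1.
have n0 : 0 < nh i k t w by exact: lt_le_trans n1.
have f0 : 0 <= f t%:R.
  by apply: le_trans ft; exact: nodal_explore_exploit_index_ge0 hspec hlambda k.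
have l0 : 0 <= ln t%:R :> R by rewrite ln_ge0 ?ler1n.
have g0 : 0 < gamma by apply: lt_trans hgamma.
have e0 : 0 < eta by case/andP: heta.
have t1 : 1 <= t%:R :> R by rewrite ler1n.
have G0 : 0 < G by exact: G_factor_gt0.
pose W := (nh i k t w + f t%:R) / M%:R.
have W0 : 0 <= W by rewrite divr_ge0 ?addr_ge0 // ltW.
have -> : tail_bound sgn i k t w =
   \sum_(h < band_count eta t) expR (- (gamma * ln t%:R)) *
     expR (tilt sigma eta (gamma * ln t%:R) ((1 + f t%:R) / M%:R) h
             * (sgn * deviation i k t w)
           - sigma ^+ 2 * tilt sigma eta (gamma * ln t%:R)
               ((1 + f t%:R) / M%:R) h ^+ 2 / 2 * quad_variation i k t w).
  apply: eq_bigr => h _; congr (_ * expR _); rewrite log_martingaleE exprMn sgn2.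
  by ring.
apply: (@one_le_sum_tilted _ _ _ _ _ hsigma heta _ _ _ _ W) => //.
- by rewrite mulr_ge0 // ltW.
- by rewrite divr_gt0 // ltr_wpDr.
- by rewrite /W ler_wpM2r ?(ltW Mi0) // lerD2r.
- rewrite /W mulrAC ler_wpM2r ?(ltW Mi0) //.
  apply: (@le_trans _ _ ((1 + f t%:R) * t%:R)).
    by have := n_hat_le i k t w; nra.
  by rewrite ler_wpM2l ?addr_ge0 // band_count_exp_ge.
- apply: le_trans (quad_variation_le i k t w) _.
  by rewrite /W ler_wpM2r ?(ltW Mi0) // lerD2l.
- apply: le_trans dev; rewrite le_eqVlt; apply/orP; left; apply/eqP.
  rewrite /width /ucb_width -/(nh i k t w) [RHS]mulrCA; congr (_ * _).
  rewrite -[X in _ = X * _]gtr0_norm // -sqrtr_sqr -sqrtrM ?sqr_ge0 //.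
  by congr Num.sqrt; rewrite /W /G; field; rewrite !gt_eqF.
Qed.

Lemma ucb_below_mean i k t w : (N <= t)%N -> (0 < t)%N -> eps_c k <= f t%:R ->
  mu_hat r sel P i k t w + width i k t w <= m i -> 1 <= tail_bound (-1) i k t w.
Proof.
move=> Nt t0 ft H; apply: tail_bound_ge1 => //; first by rewrite sqrrN expr1n.
have n0 : 0 < nh i k t w by apply: lt_le_trans (n_hat_ge1 i k w Nt).
rewrite /deviation mulN1r opprB lerBrDr.
have -> : s_hat r sel P i k t w = nh i k t w * mu_hat r sel P i k t w.
  by rewrite /mu_hat -/(nh i k t w) mulrC divfK // gt_eqF.
by rewrite -mulrDr [leRHS]mulrC ler_wpM2l ?(ltW n0) // addrC.
Qed.

Lemma lcb_above_mean i k t w : (N <= t)%N -> (0 < t)%N -> eps_c k <= f t%:R ->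
  m i <= mu_hat r sel P i k t w - width i k t w -> 1 <= tail_bound 1 i k t w.
Proof.
move=> Nt t0 ft H; apply: tail_bound_ge1 => //; first by rewrite expr1n.
have n0 : 0 < nh i k t w by apply: lt_le_trans (n_hat_ge1 i k w Nt).
rewrite /deviation mul1r lerBrDr -lerBrDl.
have -> : s_hat r sel P i k t w = nh i k t w * mu_hat r sel P i k t w.
  by rewrite /mu_hat -/(nh i k t w) mulrC divfK // gt_eqF.
by rewrite -mulrBr [leLHS]mulrC ler_wpM2l ?(ltW n0).
Qed.

Variables (istar : 'I_N) (histar : forall i, m i <= m istar) (T : nat) (hT : (0 < T)%N).
Let Delta i := m istar - m i.

(** The larger root of [x^2 = 2 q x + 2 q f(T)], the equation into which
[Delta i = 2 * width] turns, for [x = n_hat], once [ln] and [f] are taken at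
time [T]. *)
Definition exploration i : R :=
  let q := 4 * sigma ^+ 2 * gamma * ln T%:R / (Delta i ^+ 2 * M%:R * G) in
  q + Num.sqrt (q ^+ 2 + 2 * q * f T%:R).

Lemma n_hat_small i k t w : 0 < Delta i -> (N <= t)%N -> (0 < t <= T)%N ->
  eps_c k <= f t%:R -> Delta i < 2 * width i k t w -> nh i k t w < exploration i.
Proof.
move=> D0 Nt /andP[t0 tT] ft.
have M0 : 0 < M%:R :> R by rewrite ltr0n.
have n1 : 1 <= nh i k t w by exact: n_hat_ge1.
have n0 : 0 < nh i k t w by exact: lt_le_trans n1.
have f0 : 0 <= f t%:R.
  by apply: le_trans ft; exact: nodal_explore_exploit_index_ge0 hspec hlambda k.
have l0 : 0 <= ln t%:R :> R by rewrite ln_ge0 ?ler1n.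
have lT : ln t%:R <= ln T%:R :> R.
  by rewrite ler_ln ?posrE ?ltr0n ?ler_nat // (leq_trans t0).
have fT : f t%:R <= f T%:R by exact: (sublogarithmic_nat_homo hf).
have g0 : 0 < gamma by apply: lt_trans hgamma.
have G0 : 0 < G by exact: G_factor_gt0.
rewrite /width /ucb_width -/(nh i k t w); set n := nh i k t w in n0 n1 *.
set y := (X in Num.sqrt X).
have y0 : 0 <= y.
  have n0' := ltW n0; have M0' := ltW M0.
  have G0' := ltW G0; have g0' := ltW g0.
  rewrite /y; apply: mulr_ge0; last exact: divr_ge0.
  apply: mulr_ge0; first by apply: divr_ge0 => //; exact: mulr_ge0.
  by apply: divr_ge0; [exact: addr_ge0|exact: mulr_ge0].
move=> hD.
(* squaring removes the root of the width; multiplying by [n^2] then clears the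
   denominators and leaves a quadratic inequality in [n] *)
have D2 : Delta i ^+ 2 < 4 * sigma ^+ 2 * y.
  rewrite -[in ltRHS](sqr_sqrtr y0).
  have -> : 4 * sigma ^+ 2 * Num.sqrt y ^+ 2 = (2 * (sigma * Num.sqrt y)) ^+ 2.
    by ring.
  by rewrite ltr_pXn2r // nnegrE ?(ltW D0) // (le_trans _ (ltW hD)) // ltW.
rewrite /exploration; set q := _ / _.
have c0 : 0 < Delta i ^+ 2 * M%:R * G by rewrite !mulr_gt0.
have s0 := ltW hsigma; have g0' := ltW g0; have lT0 := le_trans l0 lT.
have q0 : 0 <= q by rewrite /q divr_ge0 ?(ltW c0) // !mulr_ge0.
apply: sqr_lt_root => //.
  by rewrite mulr_ge0 ?(le_trans f0 fT) // mulr_ge0.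
apply: (@lt_le_trans _ _ (2 * (4 * sigma ^+ 2 * gamma * ln t%:R /
    (Delta i ^+ 2 * M%:R * G)) * (n + f t%:R))); last first.
  rewrite -mulrDr; apply: ler_pM.
  - by rewrite mulr_ge0 // divr_ge0 ?(ltW c0) // !mulr_ge0.
  - by rewrite addr_ge0 // ltW.
  - rewrite ler_wpM2l // /q ler_wpM2r ?invr_ge0 ?(ltW c0) //.
    by rewrite ler_wpM2l // !mulr_ge0.
  - by rewrite lerD2l.
rewrite mulrA mulrAC ltr_pdivlMr //.
have -> : n ^+ 2 * (Delta i ^+ 2 * M%:R * G) = Delta i ^+ 2 * (n ^+ 2 * M%:R * G).
  by ring.
have k0 : 0 < n ^+ 2 * M%:R * G by rewrite !mulr_gt0 // exprn_gt0.
apply: (@lt_le_trans _ _ (4 * sigma ^+ 2 * y * (n ^+ 2 * M%:R * G))).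
  by rewrite ltr_pM2r.
rewrite le_eqVlt; apply/orP; left; apply/eqP.
by rewrite /y /G; field; rewrite !gt_eqF.
Qed.

Definition play_threshold i : R := M%:R * (exploration i + eps_n).

Lemma exploration_ge0 i : 0 <= exploration i.
Proof.
rewrite addr_ge0 ?sqrtr_ge0 // divr_ge0 //.
  by rewrite !mulr_ge0 ?sqr_ge0 ?ln_ge0 ?ler1n // ltW // (lt_trans ltr01).
by rewrite mulr_ge0 ?(ltW (G_factor_gt0 heta)) // mulr_ge0 ?sqr_ge0.
Qed.

Lemma play_threshold_ge0 i : 0 <= play_threshold i.
Proof.
by rewrite mulr_ge0 // addr_ge0 ?exploration_ge0 // graph_explore_exploit_index_ge0.
Qed.

(** The third of the three explanations of a suboptimal play, a wide confidence
interval, is excluded by the number of plays already made. *)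
Lemma suboptimal_play i k t w : 0 < Delta i -> (N <= t)%N -> (0 < t <= T)%N ->
  eps_c k <= f t%:R -> sel k t.+1 w = i -> play_threshold i < plays i t w ->
  1 <= tail_bound (-1) istar k t w + tail_bound 1 i k t w.
Proof.
move=> D0 Nt tT ft seli hK; have t0 : (0 < t)%N by case/andP: tT.
have [_ pol] := hpolicy k t.+1 w.
have := pol Nt istar; rewrite seli /ucb_index /= => idx.
case: (leP (mu_hat r sel P istar k t w + width istar k t w) (m istar)) => Ha.
  rewrite -[leLHS]addr0 lerD ?tail_bound_ge0 //.
  exact: ucb_below_mean.
case: (leP (m i) (mu_hat r sel P i k t w - width i k t w)) => Hb.
  by rewrite -[leLHS]add0r lerD ?tail_bound_ge0 // lcb_above_mean.
have : nh i k t w < exploration i.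
  apply: n_hat_small => //; rewrite /Delta.
  by move: idx Ha Hb; rewrite -/(width _ _ _ _) -/(width _ _ _ _); lra.
move=> nsmall; exfalso; move: hK; rewrite ltNge => /negP; apply.
apply: le_trans (plays_le i k t w) _.
by rewrite ler_wpM2l // lerD2r ltW.
Qed.

Hypothesis (hrange : forall k, (f @` D) (eps_c k)).
Let tdag k := pinv D f (eps_c k).

(** In the sampling phase every agent selects arm [i] at time [i + 1] and at no
other time; the shift by one is due to the arms being numbered from 0. *)
Lemma plays_before_sampling (i : 'I_N) t w : (t <= i)%N -> plays i t w = 0.
Proof.
move=> ti; have iN := ltn_ord i; rewrite /plays big1 // => s _; rewrite big1 // => j _.
have sN : (0 < s.+1 <= N)%N.
  by rewrite /= (leq_trans (ltn_ord s)) // ltnW // (leq_ltn_trans ti).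
have [+ _] := hpolicy j s.+1 w; move=> /(_ sN) /= E.
rewrite -(inj_eq val_inj) /= E; case: eqP => // si.
by have := ltn_ord s; rewrite si ltnNge ti.
Qed.

Lemma plays_bound i w : (2 <= N)%N -> 0 < Delta i ->
  plays i T w <= play_threshold i + M%:R
     + \sum_(k < M) Num.max 0 (tdag k - 1)
     + \sum_(k < M) \sum_(2 <= s < T)
         (tail_bound (-1) istar k s w + tail_bound 1 i k s w).
Proof.
move=> N2 D0.
have := @plays_split _ _ (fun t k => sel k t.+1 w == i) _ T (play_threshold_ge0 i).
rewrite -/(plays i T w) => /le_trans; apply.
rewrite -[leRHS]addrA lerD2l exchange_big -big_split /=.
apply: ler_sum => k _.
apply: (@le_trans _ _ (\sum_(2 <= s < T) ((s%:R < tdag k)%R%:R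
   + (tail_bound (-1) istar k s w + tail_bound 1 i k s w)))); last first.
  rewrite big_split /= lerD2r.
  by have := count_nat_lt_le (tdag k) T.-1; rewrite prednK.
rewrite big_geq_mkord [leRHS]big_mkcond /=; apply: ler_sum => t _.
rewrite -/(plays i t w).
have tb0 : 0 <= tail_bound (-1) istar k t w + tail_bound 1 i k t w.
  by rewrite addr_ge0 ?tail_bound_ge0.
have [/andP[/eqP seli hK]|_] := boolP (_ && _); last first.
  by case: ifP => // _; rewrite addr_ge0.
have Nt : (N <= t)%N.
  rewrite leqNgt; apply/negP => tN.
  have [+ _] := hpolicy k t.+1 w; rewrite tN seli => /(_ isT) /= it.
  by move: hK; rewrite plays_before_sampling ?it // ltNge play_threshold_ge0.
have t2 : (2 <= t)%N by exact: leq_trans Nt.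
rewrite t2; case: ltP => ht; first by rewrite lerDl.
rewrite add0r; apply: suboptimal_play => //.
  by rewrite (ltnW (ltn_ord t)) andbT (ltn_trans _ t2).
by apply: (le_of_pinv_le hf) => //; rewrite (ltn_trans _ t2).
Qed.

End Paths.

(** * Expectations of the tail bounds *)

Section ExpectedBound.
Context d (Omega : measurableType d) (R : realType) (Pr : probability Omega R).

(** Here [g] stands for the means collected by the agents and [Y] for the tail
bounds: the bound on the integral of [Y] makes [Y] integrable, so the pointwise
inequality can be integrated. *)
Lemma expectation_deficit_le (g Y : Omega -> R) (a b c : R) :
  Pr.-integrable [set: Omega] (fun w => (g w)%:E) ->
  measurable_fun [set: Omega] Y -> (forall w, 0 <= Y w) -> 0 <= b ->
  (\int[Pr]_w (Y w)%:E <= c%:E)%E ->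
  (forall w, a <= g w + (b + Y w)) ->
  (a%:E - 'E_Pr[g] <= (b + c)%:E)%E.
Proof.
move=> ig mY Y0 b0 Yc H; rewrite unlock.
have mbY : measurable_fun [set: Omega] (fun w => (b + Y w)%:E).
  by apply/measurable_EFinP; apply: measurable_funD.
have ibY : (\int[Pr]_w (b + Y w)%:E <= (b + c)%:E)%E.
  rewrite EFinD; under eq_integral do rewrite EFinD.
  rewrite ge0_integralD //; last 2 first.
  - by move=> w _; rewrite lee_fin.
  - exact/measurable_EFinP.
  rewrite leeD // integral_cst // -[leRHS]mule1 lee_wpmul2l ?lee_fin //.
  exact: sprobability_setT.
have jbY : Pr.-integrable [set: Omega] (fun w => (b + Y w)%:E).
  apply/integrableP; split => //.
  under eq_integral do rewrite gee0_abs ?lee_fin ?addr_ge0 //.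
  by apply: le_lt_trans ibY _; rewrite ltry.
rewrite leeBlDr ?integrable_fin_num //.
apply: (@le_trans _ _ (\int[Pr]_w ((g w)%:E + (b + Y w)%:E))%E); last first.
  by rewrite integralD // addeC leeD2r.
have <- : (\int[Pr]_w (cst a%:E w) = a%:E)%E.
  by rewrite integral_cst // [X in (_ * X)%E](@probability_setT _ _ _ Pr) mule1.
apply: le_integral => //.
- exact: finite_measure_integrable_cst.
- exact: integrableD.
- by move=> w _; rewrite -EFinD lee_fin.
Qed.

Context (M N : nat).
Variables (r : 'I_N -> 'I_M -> nat -> Omega -> R)
  (sel : 'I_M -> nat -> Omega -> 'I_N).
Hypothesis mr : forall i k t, measurable_fun [set: Omega] (r i k t).
Hypothesis msel : forall k t i, (0 < t)%N -> measurable [set w | sel k t w = i].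
Variables (m : 'I_N -> R) (sigma : R).
Hypothesis hr : subgaussian_rewards Pr r sel m sigma.

Lemma measurable_log_martingale i c n :
  measurable_fun [set: Omega] (log_martingale r sel m sigma i c n).
Proof.
move=> _ B mB; rewrite setTI; apply: (history_measurable mr msel).
have := @measurable_history_log_martingale _ _ _ _ _ r sel m sigma i c n n.+1
  (ltnSn n) measurableT B mB.
by rewrite setTI; apply.
Qed.

Lemma measurable_tail_bound e kappa gamma eta f sgn i k t :
  measurable_fun [set: Omega]
    (tail_bound e kappa m sigma r sel gamma eta f sgn i k t).
Proof.
apply: measurable_sum => h; apply: measurable_funM => //.
by apply: measurableT_comp => //; exact: measurable_log_martingale.
Qed.

Lemma expectation_tail_bound e kappa gamma eta f sgn i k t :
  (\int[Pr]_w (tail_bound e kappa m sigma r sel gamma eta f sgn i k t w)%:E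
   <= ((band_count eta t)%:R * expR (- gamma * ln t%:R))%:E)%E.
Proof.
rewrite /tail_bound; under eq_integral do rewrite -sumEFin.
have mexp c : measurable_fun [set: Omega]
    (fun w => (expR (log_martingale r sel m sigma i c t w))%:E).
  apply/measurable_EFinP; apply: measurableT_comp => //.
  exact: measurable_log_martingale.
rewrite ge0_integral_sum //; last first.
  move=> h; apply/measurable_EFinP; apply: measurable_funM => //.
  by apply/measurable_EFinP; exact: mexp.
apply: (@le_trans _ _
  (\sum_(h < band_count eta t) (expR (- gamma * ln t%:R))%:E)%E).
  apply: lee_sum => h _; under eq_integral do rewrite EFinM.
  rewrite ge0_integralZl_EFin ?expR_ge0 //.
  rewrite mulNr -[leRHS]mule1 lee_wpmul2l ?lee_fin ?expR_ge0 //.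
  exact: expectation_exp_log_martingale.
by rewrite sumEFin lee_fin sumr_const card_ord mulr_natl.
Qed.

Lemma measurable_selected_mean k t : (0 < t)%N ->
  measurable_fun [set: Omega] (fun w => m (sel k t w)).
Proof.
move=> t0.
have -> : (fun w => m (sel k t w)) =
          (fun w => \sum_(i < N) m i * \1_[set w | sel k t w = i] w).
  apply/funext => w; rewrite (bigD1 (sel k t w)) //= big1 ?addr0.
    by rewrite indicE mem_set // mulr1.
  move=> i isel; rewrite indicE memNset ?mulr0 //= => E.
  by rewrite E eqxx in isel.
apply: measurable_sum => i; apply: measurable_funM => //.
by apply: measurable_indic; exact: msel.
Qed.

Lemma integrable_selected_mean k t : (0 < t)%N ->
  Pr.-integrable [set: Omega] (fun w => (m (sel k t w))%:E).
Proof.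
move=> t0; apply: measurable_bounded_integrable => //.
- by rewrite (le_lt_trans sprobability_setT) // ltry.
- exact: measurable_selected_mean.
- exists (\sum_i `|m i|); split; first exact: num_real.
  move=> x mx w _ /=; apply: le_trans (ltW mx).
  by rewrite (bigD1 (sel k t w)) //= lerDl sumr_ge0.
Qed.

End ExpectedBound.

(** * The regret bound *)

(** Since [x k] may be less than 1, [max 0 (x k - 1)] is only at most
[(x k - 1) + 1].  The excess [M] is covered by the difference between
[gamma / (gamma - 1) = 1 + 1 / (gamma - 1)] and [1 / (gamma - 1)] in the factor
of [ln (1 + eta)], which is worth [2 * M]. *)
Lemma regret_constant_dominates (R : realType) (M : nat) (x : 'I_M -> R)
    (eps gamma eta : R) :
  (forall k, 0 < x k) -> 0 <= eps -> 1 < gamma -> 0 < eta ->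
  M%:R * eps + M%:R + \sum_(k < M) Num.max 0 (x k - 1)
    + 2 * M%:R * ((ln (1 + eta))^-1 * (((gamma - 1) ^+ 2)^-1 + 1) + (gamma - 1)^-1)
  <= regret_constant x eps gamma eta.
Proof.
move=> x0 e0 g1 eta0; rewrite /regret_constant.
have M0 : 0 <= M%:R :> R by [].
have a0 : 0 < gamma - 1 by rewrite subr_gt0.
have l0 : 0 < ln (1 + eta) by rewrite ln_gt0 // ltrDl.
have S : \sum_(k < M) Num.max 0 (x k - 1) <= \sum_(k < M) (x k - 1) + M%:R.
  rewrite -[X in _ + X%:R]card_ord -sumr_const -big_split.
  apply: ler_sum => k _ /=; rewrite subrK ge_max (ltW (x0 k)) /=.
  by rewrite lerBlDr lerDl.
have ll : ln (1 + eta) <= ln ((1 + eps) * (1 + eta)).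
  by rewrite ler_ln ?posrE ?mulr_gt0 //; nra.
have K : gamma / (gamma - 1) * ln (1 + eta)
       <= gamma * ln ((1 + eps) * (1 + eta)) / (gamma - 1).
  by rewrite mulrAC ler_wpM2r ?invr_ge0 ?(ltW a0) // ler_wpM2l //; lra.
have : 2 * M%:R / ln (1 + eta) * (1 / (gamma - 1) ^+ 2
         + gamma / (gamma - 1) * ln (1 + eta) + 1)
     <= 2 * M%:R / ln (1 + eta) * (1 / (gamma - 1) ^+ 2
         + gamma * ln ((1 + eps) * (1 + eta)) / (gamma - 1) + 1).
  by rewrite ler_wpM2l ?divr_ge0 ?mulr_ge0 ?(ltW l0) // lerD2r lerD2l.
have -> : 2 * M%:R / ln (1 + eta) * (1 / (gamma - 1) ^+ 2
         + gamma / (gamma - 1) * ln (1 + eta) + 1) =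
   2 * M%:R * ((ln (1 + eta))^-1 * (((gamma - 1) ^+ 2)^-1 + 1) + (gamma - 1)^-1)
   + 2 * M%:R.
  by field; rewrite !gt_eqF.
lra.
Qed.

Lemma explorationE (R : realType) (M N : nat) (m : 'I_N -> R)
    (sigma gamma eta : R) f istar T i :
  (0 < M)%N -> m istar - m i != 0 -> 0 < sigma -> 1 < gamma -> 0 < eta < 4 ->
  (0 < T)%N ->
  (m istar - m i) * (M%:R * exploration M m sigma gamma eta f istar T i) =
  4 * sigma ^+ 2 * gamma * ln T%:R / ((m istar - m i) * G_factor eta)
   * (1 + Num.sqrt (1 + (m istar - m i) ^+ 2 * M%:R * G_factor eta
        / (2 * gamma * sigma ^+ 2) * (f T%:R / ln T%:R))).
Proof.
move=> M0 D0 s0 g1 heta T0; rewrite /exploration.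
have G0 := G_factor_gt0 heta.
have M0' : M%:R != 0 :> R by rewrite pnatr_eq0 -lt0n.
have l0 : 0 <= ln T%:R :> R by rewrite ln_ge0 ?ler1n.
set q := 4 * _ * _ * _ / (_ * G_factor eta).
have q0 : 0 <= q.
  rewrite /q divr_ge0 //; first by rewrite mulr_ge0 // !mulr_ge0 //; lra.
  by rewrite mulr_ge0 ?(ltW G0) // mulr_ge0 ?sqr_ge0.
set y := _ / _ * (f T%:R / _).
have -> : q ^+ 2 + 2 * q * f T%:R = q ^+ 2 * (1 + y).
  rewrite mulrDr mulr1; congr (_ + _).
  have [l1|l1] := eqVneq (ln T%:R : R) 0.
    by rewrite /q l1 mulr0 !mul0r mulr0 !mul0r expr0n /= mul0r.
  by rewrite /q /y; field; rewrite l1 M0' D0 !gt_eqF //=; lra.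
rewrite sqrtrM ?sqr_ge0 // sqrtr_sqr (ger0_norm q0).
rewrite -[X in X + _ * _]mulr1 -mulrDr mulrA mulrA; congr (_ * _).
by rewrite /q; field; rewrite M0' D0 !gt_eqF.
Qed.
Theorem corollary1 (R : realType) (d : measure_display)
    (Omega : measurableType d) (Pr : probability Omega R)
    (M N : nat) (hM : (0 < M)%N)
    (* network *)
    (e : rel 'I_M) (he : connected_graph e)
    (kappa : R) (hkappa : 0 < kappa <= 1)
    (lambda : 'I_M -> R) (u : 'I_M -> 'cV[R]_M)
    (hspec : ordered_eigenbasis (consensus_matrix e kappa) lambda u)
    (hlambda : forall p : 'I_M, (0 < p)%N -> -1 < lambda p < 1)
    (* rewards *)
    (m : 'I_N -> R) (hm : injective m)
    (istar : 'I_N) (histar : forall i, m i <= m istar)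
    (sigma_g : R) (hsigma : 0 < sigma_g)
    (r : 'I_N -> 'I_M -> nat -> {RV Pr >-> R})
    (sel : 'I_M -> nat -> Omega -> 'I_N)
    (hsel : forall k t i, (0 < t)%N -> measurable [set w | sel k t w = i])
    (hr : subgaussian_rewards Pr r sel m sigma_g)
    (* algorithm *)
    (gamma eta : R) (hgamma : 1 < gamma) (heta : 0 < eta < 4)
    (D : set R) (f : R -> R) (hf : increasing_sublogarithmic D f)
    (hrange : forall k, (f @` D) (nodal_explore_exploit_index lambda u k))
    (hpolicy : coop_UCB2_policy r sel (consensus_matrix e kappa)
                 sigma_g gamma (G_factor eta) f)
    (T : nat) (hT : (0 < T)%N) :
  let Delta i := m istar - m i in
  let G := G_factor eta in
  let eps_n := graph_explore_exploit_index lambda in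
  let tdag k := pinv D f (nodal_explore_exploit_index lambda u k) in
  let L := regret_constant tdag eps_n gamma eta in
  (group_regret Pr sel m istar T <=
   (\sum_(i < N | i != istar)
       4 * sigma_g ^+ 2 * gamma * ln T%:R / (Delta i * G)
       * (1 + Num.sqrt (1 + Delta i ^+ 2 * M%:R * G / (2 * gamma * sigma_g ^+ 2)
                            * (f T%:R / ln T%:R)))
    + \sum_(i < N) L * Delta i)%:E)%E.
Proof.
pose Delta i := m istar - m i.
pose eps_n := graph_explore_exploit_index lambda.
pose tdag k := pinv D f (nodal_explore_exploit_index lambda u k).
pose L := regret_constant tdag eps_n gamma eta.
rewrite -/eps_n -/L /=.
have mr i k t : measurable_fun [set: Omega] (r i k t : Omega -> R) by [].
have D0 i : 0 <= Delta i by rewrite subr_ge0.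
have Dpos i : i != istar -> 0 < Delta i.
  move=> ne; rewrite lt_neqAle D0 andbT eq_sym subr_eq0.
  by apply: contraNneq ne => /hm ->.
have N2 i : i != istar -> (2 <= N)%N.
  move=> ne; rewrite ltnNge; apply/negP => N1; case/eqP: ne; apply: val_inj.
  have := leq_trans (ltn_ord i) N1; have := leq_trans (ltn_ord istar) N1.
  by rewrite !ltnS !leqn0 => /eqP si /eqP ii; rewrite /= si ii.
have e0 : 0 < eta by case/andP: heta.
have td0 k : 0 < tdag k := pinv_gt0 hf (hrange k).
have eps0 : 0 <= eps_n := graph_explore_exploit_index_ge0 hlambda.
pose rr i k t : Omega -> R := r i k t.
pose tb sgn i k s := tail_bound e kappa m sigma_g rr sel gamma eta f sgn i k s.
pose K i := play_threshold lambda m sigma_g gamma eta f istar T i + M%:R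
   + \sum_(k < M) Num.max 0 (tdag k - 1).
pose Y w := \sum_(i < N | i != istar) Delta i *
   \sum_(k < M) \sum_(2 <= s < T) (tb (-1) istar k s w + tb 1 i k s w).
pose g w := \sum_(1 <= t < T.+1) \sum_(k < M) m (sel k t w).
pose B := (ln (1 + eta))^-1 * (((gamma - 1) ^+ 2)^-1 + 1) + (gamma - 1)^-1.
have tb0 sgn i k s w : 0 <= tb sgn i k s w by exact: tail_bound_ge0.
have mtb sgn i k s : measurable_fun [set: Omega] (tb sgn i k s).
  exact: (measurable_tail_bound mr hsel).
have m2 i k s : measurable_fun [set: Omega]
    (fun w => tb (-1) istar k s w + tb 1 i k s w).
  exact: measurable_funD.
have mS i : measurable_fun [set: Omega] (fun w =>
    \sum_(k < M) \sum_(2 <= s < T) (tb (-1) istar k s w + tb 1 i k s w)).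
  by apply: measurable_sum => k; apply: measurable_sum => s.
have mY : measurable_fun [set: Omega] Y.
  have -> : Y = fun w => \sum_(i < N) if i != istar then Delta i *
      \sum_(k < M) \sum_(2 <= s < T) (tb (-1) istar k s w + tb 1 i k s w) else 0.
    by apply/funext => w; rewrite /Y big_mkcond.
  apply: measurable_sum => i; case: (i != istar) => //.
  exact: measurable_funM.
have S0 i w : 0 <= \sum_(k < M) \sum_(2 <= s < T)
    (tb (-1) istar k s w + tb 1 i k s w).
  by apply: sumr_ge0 => k _; apply: sumr_ge0 => s _; rewrite addr_ge0.
have Y0 w : 0 <= Y w by apply: sumr_ge0 => i _; rewrite mulr_ge0.
have ES i : (\int[Pr]_w (\sum_(k < M) \sum_(2 <= s < T)
    (tb (-1) istar k s w + tb 1 i k s w))%:E <= (2 * M%:R * B)%:E)%E.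
  under eq_integral do rewrite -sumEFin.
  rewrite ge0_integral_sum //; last 2 first.
  - by move=> k; apply/measurable_EFinP; apply: measurable_sum.
  - by move=> k w _; rewrite lee_fin sumr_ge0 // => s _; rewrite addr_ge0.
  apply: (@le_trans _ _ (\sum_(k < M) (2 * B)%:E)%E); last first.
    by rewrite sumEFin sumr_const card_ord lee_fin -[leLHS]mulr_natr mulrAC.
  apply: lee_sum => k _; under eq_integral do rewrite -sumEFin.
  rewrite ge0_integral_sum //; last 2 first.
  - by move=> s; exact/measurable_EFinP.
  - by move=> s w _; rewrite lee_fin addr_ge0.
  apply: (@le_trans _ _ (\sum_(2 <= s < T)
     (2 * ((band_count eta s)%:R * expR (- gamma * ln s%:R)))%:E)%E).
    apply: lee_sum => s _; under eq_integral do rewrite EFinD.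
    rewrite ge0_integralD //; [|by move=> w _; rewrite lee_fin
      |exact/measurable_EFinP|by move=> w _; rewrite lee_fin
      |exact/measurable_EFinP].
    by rewrite mulrDl mul1r EFinD leeD // (expectation_tail_bound mr hsel hr).
  rewrite sumEFin lee_fin -mulr_sumr ler_wpM2l //.
  by have := sum_band_tail_le T.-1 e0 hgamma; rewrite prednK.
have EY : (\int[Pr]_w (Y w)%:E <=
    (\sum_(i < N | i != istar) Delta i * (2 * M%:R * B))%:E)%E.
  rewrite /Y; under eq_integral do rewrite -sumEFin big_mkcond.
  rewrite ge0_integral_sum //; last 2 first.
  - move=> i; case: (i != istar) => //; apply/measurable_EFinP.
    exact: measurable_funM.
  - by move=> i w _; case: ifP => _ //; rewrite lee_fin mulr_ge0.
  rewrite -sumEFin [leRHS]big_mkcond; apply: lee_sum => i _.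
  case: ifP => _; last by rewrite integral0.
  under eq_integral do rewrite EFinM.
  rewrite ge0_integralZl_EFin //; last 2 first.
  - by move=> w _; rewrite lee_fin.
  - exact/measurable_EFinP.
  by rewrite [leRHS]EFinM lee_wpmul2l ?lee_fin.
have gE w : M%:R * T%:R * m istar =
    g w + \sum_(i < N | i != istar) Delta i * plays R sel i T w.
  have -> : M%:R * T%:R * m istar = \sum_(t < T) \sum_(k < M) m istar.
    by rewrite !sumr_const !card_ord -[RHS]mulrnA -[RHS]mulr_natl natrM.
  rewrite /g big_add1 /= big_mkord.
  have -> : \sum_(i < N | i != istar) Delta i * plays R sel i T w =
      \sum_(t < T) \sum_(k < M) Delta (sel k t.+1 w).
    transitivity (\sum_(i < N) Delta i * plays R sel i T w).
      rewrite [RHS](bigD1 istar) //= /Delta subrr mul0r add0r.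
      by apply: eq_bigl => i; rewrite ?andbT.
    under eq_bigr => i _ do rewrite /plays mulr_sumr.
    rewrite exchange_big; apply: eq_bigr => t _ /=.
    under eq_bigr => i _ do rewrite mulr_sumr.
    rewrite exchange_big; apply: eq_bigr => k _ /=.
    rewrite (bigD1 (sel k t.+1 w)) //= eqxx mulr1 big1 ?addr0 // => i ne.
    by rewrite eq_sym (negbTE ne) mulr0.
  rewrite -big_split; apply: eq_bigr => t _; rewrite -big_split.
  by apply: eq_bigr => k _ /=; rewrite /Delta addrC subrK.
have K0 i : 0 <= K i.
  rewrite addr_ge0 ?sumr_ge0 // => [|k _]; last by rewrite le_max lexx.
  by rewrite addr_ge0 // play_threshold_ge0.
have bound w : M%:R * T%:R * m istar <=
    g w + (\sum_(i < N | i != istar) Delta i * K i + Y w).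
  rewrite (gE w) lerD2l /Y -big_split; apply: ler_sum => i ne /=.
  rewrite -mulrDr ler_wpM2l //.
  exact: (plays_bound hM he hkappa hspec hlambda hsigma hgamma heta hf hpolicy
    hT hrange w (N2 i ne) (Dpos i ne)).
have ig : Pr.-integrable [set: Omega] (fun w => (g w)%:E).
  rewrite /g; under eq_fun do rewrite big_add1 /= big_mkord -sumEFin.
  apply: integrable_sum => // t _; under eq_fun do rewrite -sumEFin.
  apply: integrable_sum => // k _.
  exact: (@integrable_selected_mean _ _ _ Pr _ _ sel hsel m k t.+1).
apply: le_trans (expectation_deficit_le ig mY Y0 _ EY bound) _.
  by apply: sumr_ge0 => i _; rewrite mulr_ge0.
rewrite lee_fin -/L.
have -> : \sum_(i < N) L * (m istar - m i) =
          \sum_(i < N | i != istar) L * (m istar - m i).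
  by rewrite (bigD1 istar) //= subrr mulr0 add0r.
rewrite -!big_split; apply: ler_sum => i ne /=.
have Dne : m istar - m i != 0 by rewrite gt_eqF //; exact: Dpos.
rewrite -(explorationE f hM Dne hsigma hgamma heta hT).
rewrite -mulrDr [L * _]mulrC -mulrDr ler_wpM2l //.
have := regret_constant_dominates td0 eps0 hgamma e0.
by rewrite /K /play_threshold -/eps_n -/L -/B mulrDr; lra.
Qed.
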